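(* Fix $c\in\mathbb R$ and let $w_c(r)=c\left(r\coth(2r)-\frac12\right)$. Then the singular ODE $$v''+2v'\frac{vv'+w_cw_c'}{v^2-w_c^2}-4v'\coth(2r)=0,\qquad v(0)=0,\qquad v'(0)=1,$$ admits a unique (real-)analytic solution $v_c$ in a neighbourhood of the origin. This solution is odd. Moreover, $v_c$ depends analytically on the parameter $c$.
   Context: The function $r\coth(2r)-\frac12$ is extended analytically to $r=0$ by the value $0$. The ODE is singular at $r=0$; a solution near the origin is a function analytic in a neighbourhood of $0$ satisfying the initial conditions at $0$ and the equation for $r\neq0$ near $0$. *)

(* Defs.v *)
From Stdlib Require Import Reals.
From Coquelicot Require Import Coquelicot.

Open Scope R_scope.

Definition coth (x : R) : R := cosh x / sinh x.

(* [r * coth (2 * r) - 1 / 2] has a removable singularity at 0, with value 0;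
   the case distinction is needed because [/ 0] is total in Rocq. *)
Definition w (c r : R) : R :=
  if Req_EM_T r 0 then 0 else c * (r * coth (2 * r) - 1 / 2).

Definition analytic_at (f : R -> R) (x : R) : Prop :=
  exists a : nat -> R,
    locally x (fun y : R => is_pseries a (y - x) (f y)).

(* Absolute (hence order-independent) summability of a double series, phrased
   through iterated sums as in the Fubini-Tonelli theorem. *)
Definition is_abs_double_series (a : nat -> nat -> R) (l : R) : Prop :=
  (forall m : nat, ex_series (fun n => Rabs (a m n))) /\
  ex_series (fun m => Series (fun n => Rabs (a m n))) /\
  is_series (fun m => Series (fun n => a m n)) l.

Definition analytic2_at (f : R -> R -> R) (x0 y0 : R) : Prop :=
  exists (a : nat -> nat -> R) (eps : R),
    0 < eps /\
    forall x y : R, Rabs (x - x0) < eps -> Rabs (y - y0) < eps ->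
      is_abs_double_series
        (fun m n => a m n * (x - x0) ^ m * (y - y0) ^ n) (f x y).

(* Analytic solution on ]-d, d[.  The denominator is required not to vanish so
   that the quotient in the equation is a genuine one; all uses of [Derive] are
   genuine derivatives because [v] is analytic and [w c] is smooth. *)
Definition solution_on (c d : R) (v : R -> R) : Prop :=
  (forall r : R, Rabs r < d -> analytic_at v r) /\
  v 0 = 0 /\
  Derive v 0 = 1 /\
  (forall r : R, Rabs r < d -> r <> 0 ->
     v r ^ 2 - w c r ^ 2 <> 0 /\
     Derive_n v 2 r
     + 2 * Derive v r
       * ((v r * Derive v r + w c r * Derive (w c) r)
          / (v r ^ 2 - w c r ^ 2))
     - 4 * Derive v r * coth (2 * r) = 0).

(* Main.v *)
Require Import Defs.
From Stdlib Require Import Reals Lra Lia FunctionalExtensionality Classical Compare_dec Wf_nat.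
From Coquelicot Require Import Coquelicot.

Open Scope R_scope.

(** Put [v = r * y], [y = 1 + z], [p = r * z'], and
    [r * coth (2 * r) = 1 / 2 + r * q], so that [w = c * r * q]. The function [q]
    solves the Riccati equation [r * q' = - 2 * q + 2 * r - 2 * r * q ^ 2], and
    after clearing denominators the given equation becomes [r * p' + 3 * p = F],
    where every term of [F] has order at least two in [r], [q], [z], [p] and
    [r * p'] ([p_equation], [ode_iff_reduced]). Comparing coefficients of
    [r ^ k], the left sides read [(k + 2) * q_k] and
    [(k + 3) * p_k = k * (k + 3) * z_k], and the right sides involve
    earlier coefficients only. As these factors do not vanish for [k >= 1], there
    is exactly one formal solution.

    Existence and the dependence on [c] are obtained together. The recursion is
    run on power series in [r] whose coefficients are power series in [c], so that
    it is solved once, independently of any base point ([causal_fix_eq]). For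
    the norm [sum |a k m| * rho ^ k * tau ^ m], which is submultiplicative, the
    recursion maps a small ball to itself as soon as [rho] and [rho * tau] are
    small ([p_step_bounded]); the derivative [r * p'] in [F] is harmless since the
    factor [k + 1] that it produces is divided by [k + 3]. Hence the double series
    converges absolutely for [|c| < tau], [|r| < rho]. Summing it gives the
    solution [v_solution], and expanding its coefficients about [c0] shows that
    it is jointly analytic ([analytic2_ev]).

    For uniqueness, the first coefficient in which two analytic solutions differ
    is multiplied by [n * (n + 3)] in the difference of the equations
    ([solution_coefs_unique]). So the solutions agree near [0], hence on their
    common interval ([identity_theorem]). Applied to the reflected solution, the
    same comparison of coefficients gives the oddness
    ([solution_coefs_alternate]). *)

(** * Absolutely convergent double series *)

Lemma nonneg_bounded_series (a : nat -> R) (A : R) :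
  (forall n, 0 <= a n) -> (forall N, sum_f_R0 a N <= A) ->
  ex_series a /\ Series a <= A.
Proof.
  intros Ha HA.
  assert (Hex : ex_series a).
  { destruct (ex_finite_lim_seq_incr (sum_n a) A) as [l Hl].
    - intros n. rewrite sum_Sn. unfold plus; simpl. specialize (Ha (S n)). lra.
    - intros n. rewrite sum_n_Reals. apply HA.
    - exists l. exact Hl. }
  split; [exact Hex|].
  apply (is_lim_seq_le (sum_n a) (fun _ => A) (Series a) A).
  - intros n. rewrite sum_n_Reals. apply HA.
  - exact (Series_correct a Hex).
  - apply is_lim_seq_const.
Qed.

Lemma sum_f_R0_le_Series (a : nat -> R) (N : nat) :
  (forall n, 0 <= a n) -> ex_series a -> sum_f_R0 a N <= Series a.
Proof.
  intros Ha Hex.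
  rewrite <- sum_n_Reals.
  apply (is_lim_seq_incr_compare (sum_n a) (Series a)).
  - exact (Series_correct a Hex).
  - intros n. rewrite sum_Sn. unfold plus; simpl. specialize (Ha (S n)). lra.
Qed.

Lemma is_series_sum_f_R0 (a : nat -> nat -> R) (l : nat -> R) (M : nat) :
  (forall i, (i <= M)%nat -> is_series (a i) (l i)) ->
  is_series (fun n => sum_f_R0 (fun i => a i n) M) (sum_f_R0 l M).
Proof.
  induction M as [|M IH]; intros H; simpl.
  - apply H; lia.
  - apply (is_series_plus (fun n => sum_f_R0 (fun i => a i n) M) (a (S M))).
    + apply IH. intros i Hi; apply H; lia.
    + apply H; lia.
Qed.

Lemma sum_f_R0_swap (u : nat -> nat -> R) (M N : nat) :
  sum_f_R0 (fun i => sum_f_R0 (u i) N) M =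
  sum_f_R0 (fun j => sum_f_R0 (fun i => u i j) M) N.
Proof.
  induction M as [|M IH]; simpl.
  - reflexivity.
  - rewrite IH, <- plus_sum. reflexivity.
Qed.

(** Bounded partial sums of the absolute values; this makes both iterated sums
    converge. *)
Definition abs_sums_le (a : nat -> nat -> R) (A : R) : Prop :=
  forall M N, sum_f_R0 (fun m => sum_f_R0 (fun n => Rabs (a m n)) N) M <= A.

Lemma abs_sums_le_swap a A :
  abs_sums_le a A -> abs_sums_le (fun n m => a m n) A.
Proof. intros H M N. rewrite sum_f_R0_swap. apply H. Qed.

Lemma term_le_sum_f_R0 (a : nat -> R) (N k : nat) :
  (forall n, 0 <= a n) -> (k <= N)%nat -> a k <= sum_f_R0 a N.
Proof.
  intros Ha. induction N as [|N IH]; intros Hk.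
  - replace k with 0%nat by lia. simpl; lra.
  - simpl. destruct (Nat.eq_dec k (S N)) as [->|Hne].
    + pose proof (cond_pos_sum a N Ha). lra.
    + assert (a k <= sum_f_R0 a N) by (apply IH; lia).
      specialize (Ha (S N)). lra.
Qed.

Lemma abs_sums_le_row a A m : abs_sums_le a A ->
  ex_series (fun n => Rabs (a m n)).
Proof.
  intros H. apply (nonneg_bounded_series _ A).
  - intros n; apply Rabs_pos.
  - intros N. eapply Rle_trans; [|apply (H m N)].
    apply (term_le_sum_f_R0 (fun m => sum_f_R0 (fun n => Rabs (a m n)) N)); [|lia].
    intros k; apply cond_pos_sum; intros; apply Rabs_pos.
Qed.

Lemma abs_sums_le_rows a A : abs_sums_le a A ->
  ex_series (fun m => Series (fun n => Rabs (a m n))) /\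
  Series (fun m => Series (fun n => Rabs (a m n))) <= A.
Proof.
  intros H. apply nonneg_bounded_series.
  - intros m. eapply Rle_trans; [|apply (sum_f_R0_le_Series _ 0)].
    + apply cond_pos_sum; intros; apply Rabs_pos.
    + intros; apply Rabs_pos.
    + eapply abs_sums_le_row; eauto.
  - intros M.
    pose proof (is_series_sum_f_R0 (fun m n => Rabs (a m n))
      (fun m => Series (fun n => Rabs (a m n))) M
      (fun m _ => Series_correct _ (abs_sums_le_row a A m H))) as Hs.
    rewrite <- (is_series_unique _ _ Hs).
    apply nonneg_bounded_series.
    + intros n. apply cond_pos_sum; intros; apply Rabs_pos.
    + intros N. rewrite sum_f_R0_swap. apply H.
Qed.

Lemma Series_abs_swap_le a A : abs_sums_le a A ->
  Series (fun m => Series (fun n => Rabs (a m n))) <=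
  Series (fun n => Series (fun m => Rabs (a m n))).
Proof.
  intros H. apply (abs_sums_le_rows a).
  intros M N. rewrite sum_f_R0_swap.
  eapply Rle_trans; [|apply (sum_f_R0_le_Series _ N)].
  - apply sum_Rle. intros n _. apply sum_f_R0_le_Series.
    + intros; apply Rabs_pos.
    + apply (abs_sums_le_row (fun n m => a m n) A), abs_sums_le_swap, H.
  - intros n. eapply Rle_trans; [|apply (sum_f_R0_le_Series _ 0)].
    + apply cond_pos_sum; intros; apply Rabs_pos.
    + intros; apply Rabs_pos.
    + apply (abs_sums_le_row (fun n m => a m n) A), abs_sums_le_swap, H.
  - apply (abs_sums_le_rows (fun n m => a m n) A), abs_sums_le_swap, H.
Qed.

Lemma Series_Rabs_ge0 (a : nat -> R) : ex_series (fun n => Rabs (a n)) ->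
  0 <= Series (fun n => Rabs (a n)).
Proof.
  intros H. eapply Rle_trans; [|apply (sum_f_R0_le_Series _ 0 (fun n => Rabs_pos _) H)].
  apply Rabs_pos.
Qed.

Lemma ex_series_Rabs_le (a b : nat -> R) :
  (forall n, Rabs (a n) <= b n) -> ex_series b -> ex_series (fun n => Rabs (a n)).
Proof.
  intros Hab. apply (ex_series_le (V := R_CompleteNormedModule) (fun n => Rabs (a n)) b).
  intros n. unfold norm; simpl; unfold abs; simpl. rewrite Rabs_Rabsolu. apply Hab.
Qed.

(** The rest of the iterated sum after [M] rows is dominated by the rest of the
    sum of the absolute values, and for these the two orders of summation
    bound each other. *)
Lemma fubini_series a A : abs_sums_le a A ->
  is_series (fun m => Series (fun n => a m n))
            (Series (fun n => Series (fun m => a m n))).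
Proof.
  intros H.
  pose proof (abs_sums_le_swap a A H) as H'.
  pose proof (fun m => abs_sums_le_row a A m H) as Hr.
  pose proof (fun n => abs_sums_le_row _ A n H') as Hc; simpl in Hc.
  destruct (abs_sums_le_rows a A H) as [Hrs _].
  destruct (abs_sums_le_rows _ A H') as [Hcs _]; simpl in Hcs.
  set (R_ := fun m => Series (fun n => Rabs (a m n))) in *.
  set (C_ := fun n => Series (fun m => Rabs (a m n))) in *.
  assert (HB : Series R_ = Series C_).
  { apply Rle_antisym.
    - apply (Series_abs_swap_le a A H).
    - apply (Series_abs_swap_le _ A H'). }
  set (s := fun n => Series (fun m => a m n)).
  assert (Hsabs : ex_series (fun n => Rabs (s n))).
  { apply (ex_series_Rabs_le _ C_); [|exact Hcs]. intros n. apply Series_Rabs, Hc. }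
  assert (Hbound : forall M,
    Rabs (Series s - sum_f_R0 (fun m => Series (a m)) M)
    <= Series R_ - sum_f_R0 R_ M).
  { intros M.
    pose proof (is_series_sum_f_R0 a (fun m => Series (a m)) M
      (fun m _ => Series_correct _ (ex_series_Rabs _ (Hr m)))) as H1.
    pose proof (is_series_sum_f_R0 (fun m n => Rabs (a m n)) R_ M
      (fun m _ => Series_correct _ (Hr m))) as H2.
    rewrite <- (is_series_unique _ _ H1), <- (is_series_unique _ _ H2), HB.
    rewrite <- !Series_minus; try assumption; try (eexists; eassumption);
      try (apply ex_series_Rabs; assumption).
    assert (Hdom : forall n, Rabs (s n - sum_f_R0 (fun i => a i n) M)
              <= C_ n - sum_f_R0 (fun i => Rabs (a i n)) M).
    { intros n. unfold s, C_.
      rewrite (Series_incr_n (fun m => a m n) (S M)); [|lia|apply ex_series_Rabs, Hc].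
      rewrite (Series_incr_n (fun m => Rabs (a m n)) (S M)); [|lia|apply Hc].
      simpl Init.Nat.pred.
      assert (Ht : ex_series (fun k => Rabs (a (S M + k)%nat n))).
      { apply (ex_series_incr_n (fun m => Rabs (a m n)) (S M)), Hc. }
      pose proof (Series_Rabs _ Ht) as Hle.
      match goal with |- Rabs (?x + ?y - ?x) <= ?z + ?w - ?z =>
        replace (x + y - x) with y by ring; replace (z + w - z) with w by ring end.
      exact Hle. }
    assert (Hex : ex_series (fun n => C_ n - sum_f_R0 (fun i => Rabs (a i n)) M)).
    { apply (ex_series_minus C_); [exact Hcs|]. eexists; exact H2. }
    eapply Rle_trans; [apply Series_Rabs|].
    - exact (ex_series_Rabs_le _ _ Hdom Hex).
    - apply Series_le; [|exact Hex]. intros n; split; [apply Rabs_pos|apply Hdom]. }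
  assert (Hl : is_lim_seq (fun M => Series s - sum_f_R0 (fun m => Series (a m)) M) 0).
  { apply is_lim_seq_abs_0.
    apply (is_lim_seq_le_le (fun _ => 0) _ (fun M => Series R_ - sum_f_R0 R_ M)).
    - intros M; split; [apply Rabs_pos|apply Hbound].
    - apply is_lim_seq_const.
    - replace (Finite 0) with (Finite (Series R_ - Series R_)) by (f_equal; ring).
      apply is_lim_seq_minus'; [apply is_lim_seq_const|].
      apply (is_lim_seq_ext (sum_n R_)); [intros; apply sum_n_Reals|].
      exact (Series_correct _ Hrs). }
  change (is_lim_seq (sum_n (fun m => Series (a m))) (Series s)).
  apply (is_lim_seq_ext (fun M => Series s - (Series s - sum_f_R0 (fun m => Series (a m)) M))).
  { intros n. rewrite sum_n_Reals. ring. }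
  replace (Finite (Series s)) with (Finite (Series s - 0)) by (f_equal; ring).
  apply is_lim_seq_minus'; [apply is_lim_seq_const|exact Hl].
Qed.

(** * Expanding a power series about another point *)

(** Coefficients about [x0] of a power series given about [0]. *)
Definition recenter (x0 : R) (a : nat -> R) (m : nat) : R :=
  Series (fun i => if le_dec m i then a i * Binomial.C i m * x0 ^ (i - m) else 0).

Lemma binomial_C_ge0 i m : 0 <= Binomial.C i m.
Proof.
  unfold Binomial.C. apply Rmult_le_pos; [left; apply INR_fact_lt_0|].
  left; apply Rinv_0_lt_compat, Rmult_lt_0_compat; apply INR_fact_lt_0.
Qed.

Lemma sum_f_R0_pad (f : nat -> R) (n M : nat) :
  (n <= M)%nat ->
  sum_f_R0 (fun m => if le_dec m n then f m else 0) M = sum_f_R0 f n.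
Proof.
  induction M as [|M IH]; intros Hn.
  - replace n with 0%nat by lia. reflexivity.
  - destruct (Nat.eq_dec n (S M)) as [->|Hne].
    + apply sum_eq. intros i Hi. destruct (le_dec i (S M)); [reflexivity|lia].
    + simpl sum_f_R0 at 1. rewrite IH by lia.
      destruct (le_dec (S M) n); [lia|ring].
Qed.

Lemma is_series_pad (f : nat -> R) (n : nat) :
  is_series (fun m => if le_dec m n then f m else 0) (sum_f_R0 f n).
Proof.
  change (is_lim_seq (sum_n (fun m => if le_dec m n then f m else 0)) (sum_f_R0 f n)).
  apply (is_lim_seq_ext_loc (fun _ => sum_f_R0 f n)); [|apply is_lim_seq_const].
  exists n. intros M HM. rewrite sum_n_Reals, sum_f_R0_pad; auto.
Qed.

Lemma sum_f_R0_pad_le (f : nat -> R) (n M : nat) : (forall k, 0 <= f k) ->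
  sum_f_R0 (fun m => if le_dec m n then f m else 0) M <= sum_f_R0 f n.
Proof.
  intros Hf. rewrite <- (is_series_unique _ _ (is_series_pad f n)).
  apply sum_f_R0_le_Series.
  - intros k; destruct (le_dec k n); [auto|lra].
  - eexists; apply is_series_pad.
Qed.

Definition recenter_term (x0 : R) (a : nat -> R) (t : R) (i m : nat) : R :=
  (if le_dec m i then a i * Binomial.C i m * x0 ^ (i - m) else 0) * t ^ m.

(** The binomial expansion of [|x0| + tau] bounds the absolute values of the
    terms obtained from [(x0 + t) ^ i]. *)
Lemma recenter_abs_sums_le x0 tau A a t :
  0 <= tau ->
  (forall N, sum_f_R0 (fun i => Rabs (a i) * (Rabs x0 + tau) ^ i) N <= A) ->
  Rabs t <= tau -> abs_sums_le (recenter_term x0 a t) A.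
Proof.
  intros Htau Ha Ht M N. eapply Rle_trans; [|apply (Ha M)].
  apply sum_Rle. intros i _.
  apply Rle_trans with (sum_f_R0 (fun m => if le_dec m i then
      Rabs (a i) * (Binomial.C i m * Rabs t ^ m * Rabs x0 ^ (i - m)) else 0) N).
  { apply Req_le, sum_eq. intros m _. unfold recenter_term.
    destruct (le_dec m i).
    - rewrite !Rabs_mult, <- !RPow_abs, (Rabs_pos_eq (Binomial.C i m)) by apply binomial_C_ge0.
      ring.
    - rewrite Rmult_0_l, Rabs_R0; reflexivity. }
  eapply Rle_trans; [apply sum_f_R0_pad_le|].
  { intros m. apply Rmult_le_pos; [apply Rabs_pos|].
    apply Rmult_le_pos; [apply Rmult_le_pos; [apply binomial_C_ge0|]|];
      apply pow_le, Rabs_pos. }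
  rewrite (sum_eq _ (fun m => Binomial.C i m * Rabs t ^ m * Rabs x0 ^ (i - m) * Rabs (a i)))
    by (intros; ring).
  rewrite <- scal_sum.
  rewrite <- binomial. apply Rmult_le_compat_l; [apply Rabs_pos|].
  apply pow_incr. split; [|lra].
  pose proof (Rabs_pos t); pose proof (Rabs_pos x0); lra.
Qed.

Lemma recenter_bound x0 tau A a M :
  0 <= tau ->
  (forall N, sum_f_R0 (fun i => Rabs (a i) * (Rabs x0 + tau) ^ i) N <= A) ->
   sum_f_R0 (fun m => Rabs (recenter x0 a m) * tau ^ m) M <= A.
Proof.
  intros Htau Ha.
  assert (Ht : Rabs tau <= tau) by (rewrite Rabs_pos_eq; lra).
  pose proof (abs_sums_le_swap _ _ (recenter_abs_sums_le x0 tau A a tau Htau Ha Ht)) as H.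
  destruct (abs_sums_le_rows _ _ H) as [H1 H2].
  eapply Rle_trans; [|exact H2].
  eapply Rle_trans; [|apply (sum_f_R0_le_Series _ M)].
  - apply sum_Rle. intros m _.
    replace (Rabs (recenter x0 a m) * tau ^ m) with (Rabs (recenter x0 a m * tau ^ m)).
    + unfold recenter. rewrite <- Series_scal_r. apply Series_Rabs.
      exact (abs_sums_le_row _ _ m H).
    + rewrite Rabs_mult, <- RPow_abs, (Rabs_pos_eq tau) by lra. reflexivity.
  - intros m. apply Series_Rabs_ge0. exact (abs_sums_le_row _ _ m H).
  - exact H1.
Qed.

Lemma recenter_is_series x0 tau A a t :
  0 <= tau ->
  (forall N, sum_f_R0 (fun i => Rabs (a i) * (Rabs x0 + tau) ^ i) N <= A) ->
  Rabs t <= tau ->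
  is_series (fun m => recenter x0 a m * t ^ m) (Series (fun i => a i * (x0 + t) ^ i)).
Proof.
  intros Htau Ha Ht.
  pose proof (abs_sums_le_swap _ _ (recenter_abs_sums_le x0 tau A a t Htau Ha Ht)) as H.
  pose proof (fubini_series _ _ H) as Hf; simpl in Hf.
  replace (Series (fun i => a i * (x0 + t) ^ i)) with
    (Series (fun n => Series (fun m => recenter_term x0 a t n m))).
  - apply (is_series_ext (fun m => Series (fun n => recenter_term x0 a t n m))); [|exact Hf].
    intros m. unfold recenter_term. rewrite Series_scal_r. reflexivity.
  - apply Series_ext. intros i. apply is_series_unique.
    apply (is_series_ext (fun m => if le_dec m i then
      a i * (Binomial.C i m * t ^ m * x0 ^ (i - m)) else 0)).
    { intros m. unfold recenter_term.
      match goal with |- @eq _ ?x ?y => change (@eq R x y) end.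
      destruct (le_dec m i); ring. }
    replace (a i * (x0 + t) ^ i) with
      (sum_f_R0 (fun m => a i * (Binomial.C i m * t ^ m * x0 ^ (i - m))) i).
    + apply is_series_pad.
    + rewrite (Rplus_comm x0), binomial, scal_sum. apply sum_eq. intros m _.
      ring.
Qed.

(** * Formal power series in two variables *)

Definition wnorm (w : R) (N : nat) (b : nat -> R) : R :=
  sum_f_R0 (fun n => Rabs (b n) * w ^ n) N.

(** All estimates are made on truncated sums, uniformly in [K] and [M], so that
    convergence is never an issue in them. *)
Definition dnorm (rho tau : R) (K M : nat) (a : nat -> nat -> R) : R :=
  sum_f_R0 (fun k => wnorm tau M (a k) * rho ^ k) K.

Definition dbounded (rho tau A : R) (a : nat -> nat -> R) : Prop :=
  forall K M, dnorm rho tau K M a <= A.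

Definition dadd (a b : nat -> nat -> R) (k m : nat) : R := a k m + b k m.

(** A double series is read as a power series in [r] whose coefficients, its
    rows [a k], are power series in [c]. *)
Definition dmul (a b : nat -> nat -> R) (k m : nat) : R :=
  sum_f_R0 (fun i => PS_mult (a i) (b (k - i)%nat) m) k.

Definition dweight (f : nat -> R) (a : nat -> nat -> R) (k m : nat) : R :=
  f k * a k m.

Definition dscal (x : R) : (nat -> nat -> R) -> nat -> nat -> R :=
  dweight (fun _ => x).

Definition dmonom (i j k m : nat) : R :=
  if Nat.eq_dec k i then (if Nat.eq_dec m j then 1 else 0) else 0.

Lemma wnorm_ge0 w N b : 0 <= w -> 0 <= wnorm w N b.
Proof.
  intros Hw. apply cond_pos_sum. intros n.
  apply Rmult_le_pos; [apply Rabs_pos|apply pow_le, Hw].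
Qed.

Lemma dnorm_ge0 rho tau K M a : 0 <= rho -> 0 <= tau -> 0 <= dnorm rho tau K M a.
Proof.
  intros Hr Ht. apply cond_pos_sum. intros n.
  apply Rmult_le_pos; [apply wnorm_ge0, Ht|apply pow_le, Hr].
Qed.

(** The left side runs over a triangle of the square on the right. *)
Lemma sum_convolution_le (x y : nat -> R) N :
  (forall n, 0 <= x n) -> (forall n, 0 <= y n) ->
  sum_f_R0 (fun n => sum_f_R0 (fun i => x i * y (n - i)%nat) n) N <=
  sum_f_R0 x N * sum_f_R0 y N.
Proof.
  intros Hx Hy. destruct N as [|N]; [simpl; lra|].
  rewrite cauchy_finite by lia.
  match goal with |- ?u <= _ + ?v => assert (0 <= v) end.
  { apply cond_pos_sum; intros k. apply cond_pos_sum; intros l. auto using Rmult_le_pos. }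
  lra.
Qed.

Lemma wnorm_mult w N a b : 0 <= w ->
  wnorm w N (PS_mult a b) <= wnorm w N a * wnorm w N b.
Proof.
  intros Hw. eapply Rle_trans; [|apply sum_convolution_le].
  - apply sum_Rle. intros n _. unfold PS_mult.
    eapply Rle_trans; [apply Rmult_le_compat_r; [apply pow_le, Hw|apply Rsum_abs]|].
    rewrite Rmult_comm, scal_sum. apply sum_Rle. intros i Hi.
    rewrite Rabs_mult. replace n with (i + (n - i))%nat at 2 by lia.
    rewrite pow_add. apply Req_le; ring.
  - intros; apply Rmult_le_pos; [apply Rabs_pos|apply pow_le, Hw].
  - intros; apply Rmult_le_pos; [apply Rabs_pos|apply pow_le, Hw].
Qed.

Lemma wnorm_add w N a b : 0 <= w ->
  wnorm w N (fun n => a n + b n) <= wnorm w N a + wnorm w N b.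
Proof.
  intros Hw. unfold wnorm. rewrite <- plus_sum. apply sum_Rle. intros n _.
  rewrite <- Rmult_plus_distr_r. apply Rmult_le_compat_r; [apply pow_le, Hw|apply Rabs_triang].
Qed.

Lemma wnorm_scal w N x a : wnorm w N (fun n => x * a n) = Rabs x * wnorm w N a.
Proof.
  unfold wnorm. rewrite scal_sum. apply sum_eq. intros n _. rewrite Rabs_mult; ring.
Qed.

Lemma wnorm_sum w N (u : nat -> nat -> R) k : 0 <= w ->
  wnorm w N (fun m => sum_f_R0 (fun i => u i m) k) <=
  sum_f_R0 (fun i => wnorm w N (u i)) k.
Proof.
  intros Hw. induction k as [|k IH]; simpl; [apply Rle_refl|].
  eapply Rle_trans; [apply (wnorm_add w N (fun m => sum_f_R0 (fun i => u i m) k) (u (S k)) Hw)|].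
  lra.
Qed.

Lemma dnorm_add rho tau K M a b : 0 <= rho -> 0 <= tau ->
  dnorm rho tau K M (dadd a b) <= dnorm rho tau K M a + dnorm rho tau K M b.
Proof.
  intros Hr Ht. unfold dnorm. rewrite <- plus_sum. apply sum_Rle. intros n _.
  rewrite <- Rmult_plus_distr_r. apply Rmult_le_compat_r; [apply pow_le, Hr|].
  apply wnorm_add, Ht.
Qed.

Lemma dnorm_weight rho tau K M f x a : 0 <= rho -> 0 <= tau ->
  (forall k, Rabs (f k) <= x) ->
  dnorm rho tau K M (dweight f a) <= x * dnorm rho tau K M a.
Proof.
  intros Hr Ht Hf. unfold dnorm. rewrite scal_sum. apply sum_Rle. intros k _.
  unfold dweight. rewrite wnorm_scal.
  pose proof (wnorm_ge0 tau M (a k) Ht). pose proof (pow_le rho k Hr).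
  rewrite Rmult_assoc, (Rmult_comm _ x). apply Rmult_le_compat_r; [|apply Hf].
  apply Rmult_le_pos; assumption.
Qed.

(** The norm is submultiplicative even when a weight [g], such as the one of
    [r * d/dr], is put on a factor, provided a weight [f] on the product
    compensates it. This is what keeps the derivative in the equation harmless. *)
Lemma dnorm_weight_mul rho tau K M f g a b : 0 <= rho -> 0 <= tau ->
  (forall i k, (i <= k)%nat -> Rabs (f k * g i) <= 1) ->
  dnorm rho tau K M (dweight f (dmul (dweight g a) b)) <=
  dnorm rho tau K M a * dnorm rho tau K M b.
Proof.
  intros Hr Ht Hfg. eapply Rle_trans; [|apply sum_convolution_le].
  - apply sum_Rle. intros k _.
    apply Rle_trans with
      (sum_f_R0 (fun i => wnorm tau M (a i) * wnorm tau M (b (k - i)%nat)) k * rho ^ k).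
    + apply Rmult_le_compat_r; [apply pow_le, Hr|].
      apply Rle_trans with (wnorm tau M (fun m => sum_f_R0 (fun i =>
        (f k * g i) * PS_mult (a i) (b (k - i)%nat) m) k)).
      { apply Req_le, sum_eq. intros m _. do 2 f_equal.
        unfold dweight, dmul. rewrite scal_sum. apply sum_eq. intros i _.
        transitivity (g i * PS_mult (a i) (b (k - i)%nat) m * f k); [|ring].
        f_equal. unfold PS_mult. rewrite scal_sum. apply sum_eq. intros; ring. }
      eapply Rle_trans; [apply wnorm_sum, Ht|]. apply sum_Rle. intros i Hi.
      rewrite wnorm_scal.
      apply Rle_trans with (1 * wnorm tau M (PS_mult (a i) (b (k - i)%nat))).
      * apply Rmult_le_compat_r; [apply wnorm_ge0, Ht|apply Hfg, Hi].
      * rewrite Rmult_1_l. apply wnorm_mult, Ht.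
    + rewrite Rmult_comm, scal_sum. apply Req_le, sum_eq. intros i Hi.
      replace k with (i + (k - i))%nat at 2 by lia. rewrite pow_add; ring.
  - intros; apply Rmult_le_pos; [apply wnorm_ge0, Ht|apply pow_le, Hr].
  - intros; apply Rmult_le_pos; [apply wnorm_ge0, Ht|apply pow_le, Hr].
Qed.

Lemma dweight_1 a : dweight (fun _ => 1) a = a.
Proof.
  apply functional_extensionality; intros k; apply functional_extensionality; intros m.
  unfold dweight; ring.
Qed.

Lemma dnorm_mul rho tau K M a b : 0 <= rho -> 0 <= tau ->
  dnorm rho tau K M (dmul a b) <= dnorm rho tau K M a * dnorm rho tau K M b.
Proof.
  intros Hr Ht.
  pose proof (dnorm_weight_mul rho tau K M (fun _ => 1) (fun _ => 1) a b Hr Ht) as H.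
  rewrite !dweight_1 in H. apply H. intros; rewrite Rmult_1_l, Rabs_R1; lra.
Qed.

Lemma sum_f_R0_single (x : R) (i N : nat) : 0 <= x ->
  sum_f_R0 (fun n => if Nat.eq_dec n i then x else 0) N <= x.
Proof.
  intros Hx.
  assert (H : sum_f_R0 (fun n => if Nat.eq_dec n i then x else 0) N =
              if le_dec i N then x else 0).
  { induction N as [|N IH]; cbn [sum_f_R0].
    - destruct (Nat.eq_dec 0 i), (le_dec i 0); try lia; reflexivity.
    - rewrite IH. destruct (Nat.eq_dec (S N) i), (le_dec i N), (le_dec i (S N));
        try lia; ring. }
  rewrite H. destruct (le_dec i N); lra.
Qed.

Lemma dnorm_monom rho tau K M i j : 0 <= rho -> 0 <= tau ->
  dnorm rho tau K M (dmonom i j) <= rho ^ i * tau ^ j.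
Proof.
  intros Hr Ht.
  pose proof (pow_le _ i Hr) as Hri. pose proof (pow_le _ j Ht) as Htj.
  eapply Rle_trans; [|apply (sum_f_R0_single (rho ^ i * tau ^ j) i K);
    apply Rmult_le_pos; assumption].
  apply sum_Rle. intros k _. unfold dmonom, wnorm.
  destruct (Nat.eq_dec k i) as [->|].
  - rewrite Rmult_comm. apply Rmult_le_compat_l; [assumption|].
    eapply Rle_trans; [|apply (sum_f_R0_single (tau ^ j) j M); assumption].
    apply sum_Rle. intros m _. destruct (Nat.eq_dec m j) as [->|].
    + rewrite Rabs_R1; lra.
    + rewrite Rabs_R0; lra.
  - rewrite (sum_eq _ (fun _ => 0)).
    + rewrite sum_cte. lra.
    + intros; rewrite Rabs_R0; ring.
Qed.

(** * Values of double power series *)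

Definition rowsum (a : nat -> nat -> R) (c : R) (k : nat) : R := PSeries (a k) c.

Definition ev (a : nat -> nat -> R) (c r : R) : R := PSeries (rowsum a c) r.

Lemma PSeries_Series (a : nat -> R) x : PSeries a x = Series (fun n => a n * x ^ n).
Proof. reflexivity. Qed.

Lemma wnorm_CV_radius w B b x :
  (forall N, wnorm w N b <= B) -> Rabs x < w -> Rbar_lt (Rabs x) (CV_radius b).
Proof.
  intros HB Hx.
  assert (Hw : 0 <= w) by (pose proof (Rabs_pos x); lra).
  apply Rbar_lt_le_trans with w; [exact Hx|].
  apply (CV_radius_bounded b). exists B. intros n.
  eapply Rle_trans; [|apply (HB n)].
  rewrite Rabs_mult, (Rabs_pos_eq (w ^ n)) by (apply pow_le, Hw).
  apply (term_le_sum_f_R0 (fun n => Rabs (b n) * w ^ n)); [|lia].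
  intros; apply Rmult_le_pos; [apply Rabs_pos|apply pow_le, Hw].
Qed.

Lemma dbounded_terms rho tau A a c r : dbounded rho tau A a ->
  Rabs c <= tau -> Rabs r <= rho ->
  abs_sums_le (fun k m => a k m * c ^ m * r ^ k) A.
Proof.
  intros HA Hc Hr K M. eapply Rle_trans; [|apply (HA K M)].
  apply sum_Rle. intros k _. unfold wnorm. rewrite Rmult_comm, scal_sum.
  apply sum_Rle. intros m _.
  rewrite !Rabs_mult, <- !RPow_abs.
  pose proof (Rabs_pos c). pose proof (Rabs_pos r).
  apply Rmult_le_compat.
  - apply Rmult_le_pos; [apply Rabs_pos|apply pow_le; assumption].
  - apply pow_le; assumption.
  - apply Rmult_le_compat_l; [apply Rabs_pos|apply pow_incr; lra].
  - apply pow_incr; lra.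
Qed.

Lemma rowsum_wnorm rho tau A a c K : 0 <= rho -> dbounded rho tau A a ->
  Rabs c <= tau -> wnorm rho K (rowsum a c) <= A.
Proof.
  intros Hrho HA Hc.
  assert (Hr : Rabs rho <= rho) by (rewrite Rabs_pos_eq; lra).
  pose proof (dbounded_terms rho tau A a c rho HA Hc Hr) as H.
  destruct (abs_sums_le_rows _ _ H) as [H1 H2].
  eapply Rle_trans; [|exact H2].
  eapply Rle_trans; [|apply (sum_f_R0_le_Series _ K)].
  - apply sum_Rle. intros k _.
    replace (Rabs (rowsum a c k) * rho ^ k) with (Rabs (rowsum a c k * rho ^ k)).
    + unfold rowsum. rewrite PSeries_Series, <- Series_scal_r. apply Series_Rabs.
      exact (abs_sums_le_row _ _ k H).
    + rewrite Rabs_mult, <- RPow_abs, (Rabs_pos_eq rho) by lra.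
      reflexivity.
  - intros k. apply Series_Rabs_ge0. exact (abs_sums_le_row _ _ k H).
  - exact H1.
Qed.

Lemma row_CV_radius rho tau A a c k : 0 < rho -> dbounded rho tau A a ->
  Rabs c < tau -> Rbar_lt (Rabs c) (CV_radius (a k)).
Proof.
  intros Hrho HA Hc. apply (wnorm_CV_radius tau (A / rho ^ k)); [|exact Hc].
  assert (Ht : 0 <= tau) by (pose proof (Rabs_pos c); lra).
  intros M. pose proof (pow_lt rho k Hrho).
  apply (Rmult_le_reg_r (rho ^ k)); [assumption|].
  unfold Rdiv. rewrite Rmult_assoc, Rinv_l, Rmult_1_r by lra.
  eapply Rle_trans; [|apply (HA k M)].
  apply (term_le_sum_f_R0 (fun k => wnorm tau M (a k) * rho ^ k)); [|lia].
  intros; apply Rmult_le_pos; [apply wnorm_ge0, Ht|apply pow_le; lra].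
Qed.

Lemma rowsum_CV_radius rho tau A a c r : dbounded rho tau A a ->
  Rabs c < tau -> Rabs r < rho -> Rbar_lt (Rabs r) (CV_radius (rowsum a c)).
Proof.
  intros HA Hc Hr. apply (wnorm_CV_radius rho A); [|exact Hr].
  intros K. apply (rowsum_wnorm rho tau); try lra; auto.
  pose proof (Rabs_pos r); lra.
Qed.

Lemma ev_bound rho tau A a c r : dbounded rho tau A a ->
  Rabs c < tau -> Rabs r < rho -> Rabs (ev a c r) <= A.
Proof.
  intros HA Hc Hr. pose proof (rowsum_CV_radius _ _ _ _ _ _ HA Hc Hr) as HCV.
  apply CV_disk_inside in HCV.
  unfold ev. rewrite PSeries_Series.
  eapply Rle_trans; [apply Series_Rabs, HCV|].
  apply nonneg_bounded_series; [intros; apply Rabs_pos|].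
  pose proof (Rabs_pos r).
  intros N. eapply Rle_trans; [|apply (rowsum_wnorm rho tau A a c N); auto; lra].
  apply sum_Rle. intros n _. rewrite Rabs_mult, <- RPow_abs.
  apply Rmult_le_compat_l; [apply Rabs_pos|apply pow_incr; lra].
Qed.

Lemma ev_add rho tau A B a b c r : 0 < rho ->
  dbounded rho tau A a -> dbounded rho tau B b -> Rabs c < tau -> Rabs r < rho ->
  ev (dadd a b) c r = ev a c r + ev b c r.
Proof.
  intros Hrho HA HB Hc Hr. unfold ev.
  rewrite <- PSeries_plus by (eapply CV_radius_inside, rowsum_CV_radius; eassumption).
  apply PSeries_ext. intros k. unfold rowsum, PS_plus. unfold plus; simpl.
  rewrite <- PSeries_plus by (eapply CV_radius_inside, row_CV_radius; eassumption).
  reflexivity.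
Qed.

Lemma rowsum_weight f a c k : rowsum (dweight f a) c k = f k * rowsum a c k.
Proof. unfold rowsum. rewrite <- PSeries_scal. reflexivity. Qed.

Lemma ev_scal x a c r : ev (dscal x a) c r = x * ev a c r.
Proof.
  unfold ev. rewrite <- PSeries_scal. apply PSeries_ext. intros k. apply rowsum_weight.
Qed.

Lemma rowsum_mul rho tau A B a b c k : 0 < rho ->
  dbounded rho tau A a -> dbounded rho tau B b -> Rabs c < tau ->
  rowsum (dmul a b) c k = PS_mult (rowsum a c) (rowsum b c) k.
Proof.
  intros Hrho HA HB Hc. unfold rowsum, dmul. rewrite PSeries_Series.
  rewrite (Series_ext _ (fun m => sum_f_R0 (fun i =>
     PS_mult (a i) (b (k - i)%nat) m * c ^ m) k)).
  - apply is_series_unique. apply is_series_sum_f_R0. intros i Hi.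
    rewrite <- PSeries_mult by (eapply row_CV_radius; eassumption).
    apply is_pseries_R, PSeries_correct, ex_pseries_mult; eapply row_CV_radius; eassumption.
  - intros m. rewrite Rmult_comm, scal_sum. reflexivity.
Qed.

Lemma ev_mul rho tau A B a b c r : 0 < rho ->
  dbounded rho tau A a -> dbounded rho tau B b -> Rabs c < tau -> Rabs r < rho ->
  ev (dmul a b) c r = ev a c r * ev b c r.
Proof.
  intros Hrho HA HB Hc Hr. unfold ev.
  rewrite <- PSeries_mult by (eapply rowsum_CV_radius; eassumption).
  apply PSeries_ext. intros k. eapply rowsum_mul; eassumption.
Qed.

Lemma PSeries_single (i : nat) (y x : R) :
  PSeries (fun n => if Nat.eq_dec n i then y else 0) x = y * x ^ i.
Proof.
  rewrite (PSeries_decr_n_aux _ i).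
  - rewrite Rmult_comm. f_equal.
    rewrite (PSeries_ext _ (PS_plus (fun n => match n with O => y | _ => 0 end) (fun _ => 0))).
    2:{ intros n. unfold PS_decr_n, PS_plus, plus; simpl.
        destruct (Nat.eq_dec (i + n) i), n; try lia; ring. }
    apply is_pseries_unique. apply is_pseries_R.
    change (is_lim_seq (sum_n (fun n => PS_plus (fun n => match n with O => y | _ => 0 end)
       (fun _ => 0) n * x ^ n)) y).
    apply (is_lim_seq_ext (fun _ => y)); [|apply is_lim_seq_const].
    intros n. rewrite sum_n_Reals. unfold PS_plus, plus; simpl.
    induction n as [|n IH]; simpl; [ring|]. rewrite <- IH. ring.
  - intros k Hk. destruct (Nat.eq_dec k i); [lia|reflexivity].
Qed.

Lemma ev_monom i j c r : ev (dmonom i j) c r = r ^ i * c ^ j.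
Proof.
  unfold ev. rewrite (PSeries_ext _ (fun n => if Nat.eq_dec n i then c ^ j else 0)).
  - rewrite PSeries_single. ring.
  - intros k. unfold rowsum, dmonom. destruct (Nat.eq_dec k i).
    + rewrite PSeries_single. ring.
    + apply PSeries_const_0.
Qed.

Lemma ev_weight_INR a c r :
  ev (dweight INR a) c r = r * PSeries (PS_derive (rowsum a c)) r.
Proof.
  unfold ev. rewrite <- PSeries_incr_1. apply PSeries_ext. intros [|k].
  - rewrite rowsum_weight. simpl. apply Rmult_0_l.
  - rewrite rowsum_weight. reflexivity.
Qed.

(** * Strictly causal recursions *)

Definition null_row : nat -> R := fun _ => 0.

Definition agree_below (k : nat) (a b : nat -> nat -> R) : Prop :=
  forall i, (i < k)%nat -> a i = b i.

(** The row [k] of [G x] is computed from the earlier rows of [x] only, as far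
    as series without constant row are concerned. *)
Definition strictly_causal (G : (nat -> nat -> R) -> nat -> nat -> R) : Prop :=
  (forall x, x 0%nat = null_row -> G x 0%nat = null_row) /\
  (forall k x y, x 0%nat = null_row -> y 0%nat = null_row ->
     agree_below k x y -> G x k = G y k).

(** Iterating a strictly causal map changes the row [k] no more after [S k]
    steps. *)
Definition causal_fix (G : (nat -> nat -> R) -> nat -> nat -> R) : nat -> nat -> R :=
  fun k => Nat.iter (S k) G (fun _ => null_row) k.

Lemma iter_row_0 G n : strictly_causal G ->
  Nat.iter n G (fun _ => null_row) 0%nat = null_row.
Proof.
  intros [H0 _]. induction n as [|n IH]; [reflexivity|]. apply H0, IH.
Qed.

Lemma iter_stable G n m i : strictly_causal G -> (i < n)%nat -> (n <= m)%nat ->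
  Nat.iter m G (fun _ => null_row) i = Nat.iter n G (fun _ => null_row) i.
Proof.
  intros HG Hi Hnm.
  assert (Hstep : forall n, agree_below n (Nat.iter (S n) G (fun _ => null_row))
                                   (Nat.iter n G (fun _ => null_row))).
  { clear - HG. induction n as [|n IH]; intros i Hi; [lia|].
    change (G (Nat.iter (S n) G (fun _ => null_row)) i = G (Nat.iter n G (fun _ => null_row)) i).
    apply HG; try (apply iter_row_0; assumption).
    intros j Hj. apply IH. lia. }
  induction Hnm as [|m Hnm IH]; [reflexivity|].
  rewrite <- IH. apply Hstep. lia.
Qed.

Lemma causal_fix_iter G n i : strictly_causal G -> (i < n)%nat ->
  causal_fix G i = Nat.iter n G (fun _ => null_row) i.
Proof. intros HG Hi. symmetry. apply iter_stable; auto. Qed.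

Lemma causal_fix_row_0 G : strictly_causal G -> causal_fix G 0%nat = null_row.
Proof. intros HG. apply (iter_row_0 G 1 HG). Qed.

Lemma causal_fix_eq G : strictly_causal G -> G (causal_fix G) = causal_fix G.
Proof.
  intros HG. apply functional_extensionality. intros k.
  rewrite (causal_fix_iter G (S (S k)) k HG) by lia.
  change (G (causal_fix G) k = G (Nat.iter (S k) G (fun _ => null_row)) k).
  apply HG.
  - apply causal_fix_row_0, HG.
  - apply iter_row_0, HG.
  - intros i Hi. apply causal_fix_iter; [exact HG|lia].
Qed.

(** A truncated norm sees only finitely many rows, on which the fixed point is
    an iterate; so no convergence of the iterates in norm is needed. *)
Lemma causal_fix_bounded rho tau A G : strictly_causal G -> 0 <= A ->
  (forall x, x 0%nat = null_row -> dbounded rho tau A x -> dbounded rho tau A (G x)) ->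
  dbounded rho tau A (causal_fix G).
Proof.
  intros HG HA Hball.
  assert (Hit : forall n, dbounded rho tau A (Nat.iter n G (fun _ => null_row))).
  { induction n as [|n IH].
    - intros K M. eapply Rle_trans; [|exact HA]. apply Req_le.
      unfold dnorm, wnorm, null_row; simpl.
      rewrite (sum_eq _ (fun _ => 0)); [rewrite sum_cte; ring|].
      intros k _. rewrite (sum_eq _ (fun _ => 0)); [rewrite sum_cte; ring|].
      intros. rewrite Rabs_R0; ring.
    - apply Hball; [apply iter_row_0, HG|exact IH]. }
  intros K M. eapply Rle_trans; [|apply (Hit (S K) K M)].
  apply Req_le, sum_eq. intros k Hk. rewrite (causal_fix_iter G (S K) k HG) by lia.
  reflexivity.
Qed.

Lemma agree_below_refl k a : agree_below k a a.
Proof. intros i _; reflexivity. Qed.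

Lemma agree_below_add k a a' b b' : agree_below k a a' -> agree_below k b b' ->
  agree_below k (dadd a b) (dadd a' b').
Proof. intros Ha Hb i Hi. unfold dadd. rewrite (Ha i Hi), (Hb i Hi). reflexivity. Qed.

Lemma agree_below_weight k f a a' : agree_below k a a' ->
  agree_below k (dweight f a) (dweight f a').
Proof. intros Ha i Hi. unfold dweight. rewrite (Ha i Hi). reflexivity. Qed.

Lemma agree_below_mul k a a' b b' : agree_below k a a' -> agree_below k b b' ->
  agree_below k (dmul a b) (dmul a' b').
Proof.
  intros Ha Hb i Hi. apply functional_extensionality; intros m.
  apply sum_eq. intros j Hj. rewrite (Ha j), (Hb (i - j)%nat) by lia. reflexivity.
Qed.

Lemma add_row_0 a b : a 0%nat = null_row -> b 0%nat = null_row ->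
  dadd a b 0%nat = null_row.
Proof.
  intros Ha Hb. apply functional_extensionality; intros m.
  unfold dadd. rewrite Ha, Hb. unfold null_row; ring.
Qed.

Lemma weight_row_0 f a : a 0%nat = null_row -> dweight f a 0%nat = null_row.
Proof.
  intros Ha. apply functional_extensionality; intros m.
  unfold dweight. rewrite Ha. unfold null_row; ring.
Qed.

Lemma PS_mult_null_l b m : PS_mult null_row b m = 0.
Proof.
  unfold PS_mult, null_row. rewrite (sum_eq _ (fun _ => 0)); [rewrite sum_cte|intros]; ring.
Qed.

Lemma PS_mult_null_r b m : PS_mult b null_row m = 0.
Proof.
  unfold PS_mult, null_row. rewrite (sum_eq _ (fun _ => 0)); [rewrite sum_cte|intros]; ring.
Qed.

Lemma mul_row_0 a b : a 0%nat = null_row -> dmul a b 0%nat = null_row.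
Proof.
  intros Ha. apply functional_extensionality; intros m.
  unfold dmul; simpl. rewrite Ha. apply PS_mult_null_l.
Qed.

(** In a product of two series without constant row, the row [k] of a factor
    meets a null row of the other one. *)
Lemma mul_row_agree k a a' b b' :
  a 0%nat = null_row -> a' 0%nat = null_row ->
  b 0%nat = null_row -> b' 0%nat = null_row ->
  agree_below k a a' -> agree_below k b b' -> dmul a b k = dmul a' b' k.
Proof.
  intros Ha0 Ha0' Hb0 Hb0' Ha Hb. apply functional_extensionality; intros m.
  apply sum_eq. intros i Hi.
  destruct (Nat.eq_dec i 0) as [->|Hi0].
  - rewrite Ha0, Ha0', !PS_mult_null_l. reflexivity.
  - destruct (Nat.eq_dec i k) as [->|Hik].
    + rewrite Nat.sub_diag, Hb0, Hb0', !PS_mult_null_r. reflexivity.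
    + rewrite (Ha i), (Hb (k - i)%nat) by lia. reflexivity.
Qed.

Lemma mul_row_agree_r k a b b' : a 0%nat = null_row -> agree_below k b b' ->
  dmul a b k = dmul a b' k.
Proof.
  intros Ha Hb. apply functional_extensionality; intros m.
  apply sum_eq. intros i Hi.
  destruct (Nat.eq_dec i 0) as [->|Hi0].
  - rewrite Ha, !PS_mult_null_l. reflexivity.
  - rewrite (Hb (k - i)%nat) by lia. reflexivity.
Qed.

Lemma add_row_agree k a a' b b' : a k = a' k -> b k = b' k ->
  dadd a b k = dadd a' b' k.
Proof. intros Ha Hb. unfold dadd. rewrite Ha, Hb. reflexivity. Qed.

Lemma weight_row_agree k f a a' : a k = a' k -> dweight f a k = dweight f a' k.
Proof. intros Ha. unfold dweight. rewrite Ha. reflexivity. Qed.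

(** * The recursions for the equation *)

Lemma dbounded_le rho tau A B a : dbounded rho tau A a -> A <= B -> dbounded rho tau B a.
Proof. intros H HAB K M. specialize (H K M). lra. Qed.

Lemma dbounded_add rho tau A B a b : 0 <= rho -> 0 <= tau ->
  dbounded rho tau A a -> dbounded rho tau B b -> dbounded rho tau (A + B) (dadd a b).
Proof.
  intros Hr Ht HA HB K M. pose proof (dnorm_add rho tau K M a b Hr Ht).
  specialize (HA K M). specialize (HB K M). lra.
Qed.

Lemma dbounded_mul rho tau A B a b : 0 <= rho -> 0 <= tau ->
  dbounded rho tau A a -> dbounded rho tau B b -> dbounded rho tau (A * B) (dmul a b).
Proof.
  intros Hr Ht HA HB K M.
  eapply Rle_trans; [apply dnorm_mul; assumption|].
  apply Rmult_le_compat; auto using dnorm_ge0.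
Qed.

Lemma dbounded_weight rho tau A f x a : 0 <= rho -> 0 <= tau ->
  (forall k, Rabs (f k) <= x) -> dbounded rho tau A a ->
  dbounded rho tau (x * A) (dweight f a).
Proof.
  intros Hr Ht Hf HA K M.
  eapply Rle_trans; [apply dnorm_weight; eauto|].
  apply Rmult_le_compat_l; auto.
  eapply Rle_trans; [apply Rabs_pos|apply (Hf 0%nat)].
Qed.

Lemma dbounded_scal rho tau A x a : 0 <= rho -> 0 <= tau ->
  dbounded rho tau A a -> dbounded rho tau (Rabs x * A) (dscal x a).
Proof. intros Hr Ht HA. eapply dbounded_weight; auto. intros; lra. Qed.

Lemma dbounded_monom rho tau i j : 0 <= rho -> 0 <= tau ->
  dbounded rho tau (rho ^ i * tau ^ j) (dmonom i j).
Proof. intros Hr Ht K M. apply dnorm_monom; assumption. Qed.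

Lemma Rabs_inv_INR_plus_le k x : 0 < x -> Rabs (/ (INR k + x)) <= / x.
Proof.
  intros Hx. pose proof (pos_INR k).
  rewrite Rabs_pos_eq by (left; apply Rinv_0_lt_compat; lra).
  apply Rinv_le_contravar; lra.
Qed.

(** [q] is to be [(r * coth (2 * r) - 1 / 2) / r]; then
    [r * q' = - 2 * q + 2 * r - 2 * r * q ^ 2]. *)
Definition q_step (x : nat -> nat -> R) : nat -> nat -> R :=
  dweight (fun k => / (INR k + 2))
    (dadd (dscal 2 (dmonom 1 0)) (dscal (-2) (dmul (dmonom 1 0) (dmul x x)))).

Definition q_series : nat -> nat -> R := causal_fix q_step.

Lemma monom_row_0 i j : dmonom (S i) j 0%nat = null_row.
Proof. reflexivity. Qed.

Lemma q_step_causal : strictly_causal q_step.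
Proof.
  split.
  - intros x Hx. apply weight_row_0, add_row_0; apply weight_row_0.
    + apply monom_row_0.
    + apply mul_row_0, monom_row_0.
  - intros k x y Hx Hy Hxy. apply weight_row_agree, add_row_agree; [reflexivity|].
    apply weight_row_agree, mul_row_agree_r; [apply monom_row_0|].
    apply agree_below_mul; assumption.
Qed.

Lemma q_series_bounded rho tau : 0 <= rho <= 1 / 2 -> 0 <= tau ->
  dbounded rho tau (2 * rho) q_series.
Proof.
  intros Hr Ht. apply causal_fix_bounded; [apply q_step_causal|lra|].
  intros x _ Hx. destruct Hr as [Hr Hr'].
  eapply dbounded_le.
  - eapply (dbounded_weight _ _ _ _ (/ 2)); [exact Hr|exact Ht| |].
    + intros k. apply Rabs_inv_INR_plus_le; lra.
    + eapply dbounded_add; [exact Hr|exact Ht|eapply dbounded_scal; [exact Hr|exact Ht|]..].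
      * apply dbounded_monom; assumption.
      * repeat eapply dbounded_mul; try eassumption. apply dbounded_monom; assumption.
  - rewrite (Rabs_pos_eq 2), (Rabs_left (-2)) by lra. simpl. nra.
Qed.

Definition rq_series : nat -> nat -> R := dmul (dmonom 1 0) q_series.

(** [(w / r) ^ 2]. *)
Definition w2_series : nat -> nat -> R := dmul (dmonom 0 2) (dmul q_series q_series).

(** By the Riccati equation of [q], this is [w * w' / r + (w / r) ^ 2]. *)
Definition ww_series : nat -> nat -> R :=
  dscal 2 (dmul (dmonom 0 2) (dmul rq_series
    (dadd (dmonom 0 0) (dscal (-1) (dmul q_series q_series))))).

(** [(v ^ 2 - w ^ 2) / r ^ 2 - 1] for [v = r * (1 + z)]. *)
Definition excess_series (z : nat -> nat -> R) : nat -> nat -> R :=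
  dadd (dadd (dscal 2 z) (dmul z z)) (dscal (-1) w2_series).

(** The primitive for [r * d/dr]. As [/ 0 = 0], it has no constant row. *)
Definition dint (x : nat -> nat -> R) : nat -> nat -> R := dweight (fun k => / INR k) x.

(** The equation for [x = r * z'] solved for its linear part [r * x' + 3 * x].
    All other terms are products of two series without constant row, or multiples
    of [r * q] or of [w * w' / r + (w / r) ^ 2]: this makes the step strictly
    causal. The first product contains [r * x' + x], whose weight [INR k + 1] is
    absorbed by the division by [INR k + 3]. *)
Definition p_step (x : nat -> nat -> R) : nat -> nat -> R :=
  let z := dint x in
  let E := excess_series z in
  dadd
    (dweight (fun k => - / (INR k + 3)) (dmul (dweight (fun k => INR k + 1) x) E))
    (dweight (fun k => / (INR k + 3))
      (dadd
        (dscal (-2) (dadd (dmul z x)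
           (dadd ww_series (dmul (dadd z x) (dadd x (dadd (dmul z x) ww_series))))))
        (dscal 4 (dmul rq_series
           (dmul (dadd (dmonom 0 0) (dadd z x)) (dadd (dmonom 0 0) E)))))).

Definition p_series : nat -> nat -> R := causal_fix p_step.

Definition z_series : nat -> nat -> R := dint p_series.

Lemma q_row_0 : q_series 0%nat = null_row.
Proof. apply causal_fix_row_0, q_step_causal. Qed.

Lemma rq_row_0 : rq_series 0%nat = null_row.
Proof. apply mul_row_0, monom_row_0. Qed.

Lemma mul_row_0_r a b : b 0%nat = null_row -> dmul a b 0%nat = null_row.
Proof.
  intros Hb. apply functional_extensionality; intros m.
  unfold dmul; simpl. rewrite Hb. apply PS_mult_null_r.
Qed.

Lemma w2_row_0 : w2_series 0%nat = null_row.
Proof. apply mul_row_0_r, mul_row_0, q_row_0. Qed.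

Lemma ww_row_0 : ww_series 0%nat = null_row.
Proof. apply weight_row_0, mul_row_0_r, mul_row_0, rq_row_0. Qed.

Lemma excess_row_0 z : z 0%nat = null_row -> excess_series z 0%nat = null_row.
Proof.
  intros Hz. apply add_row_0; [apply add_row_0|apply weight_row_0, w2_row_0].
  - apply weight_row_0, Hz.
  - apply mul_row_0, Hz.
Qed.

Lemma p_step_causal : strictly_causal p_step.
Proof.
  split.
  - intros x Hx. pose proof (weight_row_0 (fun k => / INR k) x Hx) as Hz.
    apply add_row_0; apply weight_row_0.
    + apply mul_row_0, weight_row_0, Hx.
    + apply add_row_0; apply weight_row_0.
      * apply add_row_0; [apply mul_row_0, Hz|].
        apply add_row_0; [apply ww_row_0|apply mul_row_0, add_row_0; assumption].
      * apply mul_row_0, rq_row_0.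
  - intros k x y Hx Hy Hxy.
    pose proof (weight_row_0 (fun k => / INR k) x Hx) as Hzx.
    pose proof (weight_row_0 (fun k => / INR k) y Hy) as Hzy.
    pose proof (agree_below_weight k (fun k => / INR k) x y Hxy) as Hz.
    fold (dint x) in *. fold (dint y) in *.
    assert (HE : agree_below k (excess_series (dint x)) (excess_series (dint y))).
    { apply agree_below_add; [apply agree_below_add|apply agree_below_refl].
      - apply agree_below_weight, Hz.
      - apply agree_below_mul; assumption. }
    apply add_row_agree; apply weight_row_agree.
    + apply mul_row_agree; auto using weight_row_0, excess_row_0, agree_below_weight.
    + apply add_row_agree; apply weight_row_agree.
      * apply add_row_agree; [apply mul_row_agree; assumption|].
        apply add_row_agree; [reflexivity|].
        apply mul_row_agree;
          auto 6 using add_row_0, mul_row_0, ww_row_0, agree_below_add, agree_below_mul,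
            agree_below_refl.
      * apply mul_row_agree_r; [apply rq_row_0|].
        apply agree_below_mul; auto using agree_below_add, agree_below_refl.
Qed.

Lemma dint_bounded rho tau A x : 0 <= rho -> 0 <= tau ->
  dbounded rho tau A x -> dbounded rho tau A (dint x).
Proof.
  intros Hr Ht HA. rewrite <- (Rmult_1_l A). eapply dbounded_weight; auto.
  intros [|k].
  - simpl. rewrite Rinv_0, Rabs_R0. lra.
  - rewrite S_INR. eapply Rle_trans; [apply Rabs_inv_INR_plus_le|]; lra.
Qed.

(** [c] ranges over [|c| < tau] and [r] over [|r| < rho]. Since [q] has norm at
    most [2 * rho], the bound on [rho * tau] makes [w / r = c * q] at most
    [1 / 10], and then [p_step] maps the ball of radius [1 / 10] to itself. *)
Definition admissible (rho tau : R) : Prop :=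
  0 < rho <= 1 / 20 /\ 1 <= tau /\ rho * tau <= 1 / 20.

Lemma rq_bounded rho tau : admissible rho tau -> dbounded rho tau (1 / 200) rq_series.
Proof.
  intros [Hr [Ht Hrt]]. eapply dbounded_le.
  - eapply dbounded_mul; [lra|lra|apply dbounded_monom; lra|apply q_series_bounded; lra].
  - simpl. nra.
Qed.

Lemma w2_bounded rho tau : admissible rho tau -> dbounded rho tau (1 / 100) w2_series.
Proof.
  intros [Hr [Ht Hrt]]. eapply dbounded_le.
  - eapply dbounded_mul; [lra|lra|apply dbounded_monom; lra|].
    eapply dbounded_mul; [lra|lra|apply q_series_bounded; lra..].
  - assert (0 <= (rho * tau) ^ 2 <= 1 / 400) by (assert (0 <= rho * tau) by nra; split; nra).
    match goal with |- ?u <= _ => replace u with (4 * (rho * tau) ^ 2) by ring end.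
    lra.
Qed.

Lemma ww_bounded rho tau : admissible rho tau -> dbounded rho tau (2 / 100) ww_series.
Proof.
  intros [Hr [Ht Hrt]]. eapply dbounded_le.
  - eapply dbounded_scal; [lra|lra|].
    eapply dbounded_mul; [lra|lra|apply dbounded_monom; lra|].
    eapply dbounded_mul; [lra|lra|eapply dbounded_mul; [lra|lra|apply dbounded_monom; lra|
      apply q_series_bounded; lra]|].
    eapply dbounded_add; [lra|lra|apply dbounded_monom; lra|].
    eapply dbounded_scal; [lra|lra|].
    eapply dbounded_mul; [lra|lra|apply q_series_bounded; lra..].
  - rewrite (Rabs_pos_eq 2), (Rabs_left (-1)) by lra. simpl.
    assert (0 <= (rho * tau) ^ 2 <= 1 / 400) by (assert (0 <= rho * tau) by nra; split; nra).
    assert (0 <= rho ^ 2 <= 1 / 400) by (split; nra).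
    match goal with |- ?u <= _ =>
      replace u with (4 * (rho * tau) ^ 2 * (1 + 4 * rho ^ 2)) by ring end.
    nra.
Qed.

Lemma excess_bounded rho tau z : admissible rho tau ->
  dbounded rho tau (1 / 10) z -> dbounded rho tau (22 / 100) (excess_series z).
Proof.
  intros Had Hz. pose proof Had as [Hr [Ht Hrt]]. eapply dbounded_le.
  - eapply dbounded_add; [lra|lra|eapply dbounded_add; [lra|lra|..]|].
    + eapply dbounded_scal; [lra|lra|exact Hz].
    + eapply dbounded_mul; [lra|lra|exact Hz..].
    + eapply dbounded_scal; [lra|lra|apply w2_bounded, Had].
  - rewrite (Rabs_pos_eq 2), (Rabs_left (-1)) by lra. lra.
Qed.

Lemma one_bounded rho tau : 0 <= rho -> 0 <= tau -> dbounded rho tau 1 (dmonom 0 0).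
Proof.
  intros Hr Ht. eapply dbounded_le; [apply dbounded_monom; assumption|simpl; lra].
Qed.

Lemma p_step_bounded rho tau x : admissible rho tau ->
  dbounded rho tau (1 / 10) x -> dbounded rho tau (1 / 10) (p_step x).
Proof.
  intros Had Hx. pose proof Had as [[Hr Hr'] [Ht Hrt]].
  assert (Hr0 : 0 <= rho) by lra. assert (Ht0 : 0 <= tau) by lra.
  pose proof (dint_bounded rho tau _ x Hr0 Ht0 Hx) as Hz.
  pose proof (excess_bounded rho tau _ Had Hz) as HE.
  pose proof (ww_bounded rho tau Had) as HB.
  pose proof (rq_bounded rho tau Had) as HQ.
  pose proof (one_bounded rho tau Hr0 Ht0) as H1.
  eapply dbounded_le.
  - eapply dbounded_add; [assumption|assumption| |].
    + intros K M. eapply Rle_trans; [apply dnorm_weight_mul; try assumption|].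
      * intros i k Hik. apply le_INR in Hik. pose proof (pos_INR i).
        rewrite Rabs_mult, Rabs_Ropp, <- Rabs_mult, Rabs_pos_eq.
        -- apply (Rmult_le_reg_l (INR k + 3)); [lra|].
           rewrite <- Rmult_assoc, Rinv_r by lra. lra.
        -- apply Rmult_le_pos; [left; apply Rinv_0_lt_compat; lra|lra].
      * apply Rmult_le_compat; auto using dnorm_ge0.
    + eapply (dbounded_weight _ _ _ _ (/ 3)); [assumption|assumption| |].
      * intros k. apply Rabs_inv_INR_plus_le; lra.
      * eapply dbounded_add; [assumption|assumption|eapply dbounded_scal; [assumption|assumption|]..].
        -- repeat first [eassumption | eapply dbounded_add | eapply dbounded_mul].
        -- repeat first [eassumption | eapply dbounded_add | eapply dbounded_mul].
  - rewrite (Rabs_left (-2)), (Rabs_pos_eq 4) by lra. lra.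
Qed.

Lemma p_series_bounded rho tau : admissible rho tau ->
  dbounded rho tau (1 / 10) p_series.
Proof.
  intros Had. apply causal_fix_bounded; [apply p_step_causal|lra|].
  intros x _ Hx. apply p_step_bounded; assumption.
Qed.

Lemma z_series_bounded rho tau : admissible rho tau ->
  dbounded rho tau (1 / 10) z_series.
Proof.
  intros Had. pose proof Had as [Hr [Ht _]].
  apply dint_bounded; [lra|lra|apply p_series_bounded, Had].
Qed.

(** * The equations satisfied by the sums *)

(** The derivative of [ev a c] at [r]. *)
Definition dev (a : nat -> nat -> R) (c r : R) : R := PSeries (PS_derive (rowsum a c)) r.

Lemma is_derive_ev rho tau A a c r : dbounded rho tau A a ->
  Rabs c < tau -> Rabs r < rho -> is_derive (ev a c) r (dev a c r).
Proof.
  intros HA Hc Hr. apply is_derive_PSeries. eapply rowsum_CV_radius; eassumption.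
Qed.

Lemma dbounded_shrink rho rho' tau A a : 0 <= rho' <= rho -> 0 <= tau ->
  dbounded rho tau A a -> dbounded rho' tau A a.
Proof.
  intros Hr Ht HA K M. eapply Rle_trans; [|apply (HA K M)].
  apply sum_Rle. intros k _. apply Rmult_le_compat_l; [apply wnorm_ge0, Ht|].
  apply pow_incr, Hr.
Qed.

(** Differentiation costs a smaller radius: by Bernoulli's inequality
    [k * rho' ^ k] is at most a constant times [rho ^ k]. *)
Lemma dbounded_weight_INR rho rho' tau A a : 0 < rho' < rho -> 0 <= tau ->
  dbounded rho tau A a -> exists B, dbounded rho' tau B (dweight INR a).
Proof.
  intros Hr Ht HA.
  set (x := rho / rho' - 1).
  assert (Hx : 0 < x).
  { unfold x. apply Rlt_0_minus. apply (Rmult_lt_reg_r rho'); [lra|].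
    unfold Rdiv. rewrite Rmult_assoc, Rinv_l; lra. }
  exists (/ x * A). intros K M.
  apply Rle_trans with (/ x * dnorm rho tau K M a).
  - unfold dnorm. rewrite scal_sum. apply sum_Rle. intros k _.
    unfold dweight. rewrite wnorm_scal, Rabs_pos_eq by apply pos_INR.
    rewrite (Rmult_comm (INR k)), !Rmult_assoc.
    apply Rmult_le_compat_l; [apply wnorm_ge0, Ht|].
    replace rho with (rho' * (1 + x)) by (unfold x; field; lra).
    rewrite Rpow_mult_distr.
    pose proof (poly k x Hx). pose proof (pow_lt rho' k (proj1 Hr)).
    rewrite (Rmult_comm (INR k)), Rmult_assoc. apply Rmult_le_compat_l; [lra|].
    apply (Rmult_le_reg_r x); [exact Hx|].
    rewrite Rmult_assoc, Rinv_l, Rmult_1_r by lra. lra.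
  - apply Rmult_le_compat_l; [left; apply Rinv_0_lt_compat, Hx|apply HA].
Qed.

(** [a] sums to [x] at [(c, r)], in a form that is stable under sums and
    products. *)
Definition sums_to (rho tau : R) (a : nat -> nat -> R) (c r x : R) : Prop :=
  (exists A, dbounded rho tau A a) /\ ev a c r = x.

Lemma sums_to_ev rho tau A a c r : dbounded rho tau A a -> sums_to rho tau a c r (ev a c r).
Proof. intros HA. split; [exists A; exact HA|reflexivity]. Qed.

Lemma sums_to_add rho tau a b c r x y : 0 < rho -> Rabs c < tau -> Rabs r < rho ->
  sums_to rho tau a c r x -> sums_to rho tau b c r y ->
  sums_to rho tau (dadd a b) c r (x + y).
Proof.
  intros Hrho Hc Hr [[A HA] <-] [[B HB] <-]. pose proof (Rabs_pos c). split.
  - eexists. eapply dbounded_add; try eassumption; lra.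
  - eapply ev_add; eassumption.
Qed.

Lemma sums_to_mul rho tau a b c r x y : 0 < rho -> Rabs c < tau -> Rabs r < rho ->
  sums_to rho tau a c r x -> sums_to rho tau b c r y ->
  sums_to rho tau (dmul a b) c r (x * y).
Proof.
  intros Hrho Hc Hr [[A HA] <-] [[B HB] <-]. pose proof (Rabs_pos c). split.
  - eexists. eapply dbounded_mul; try eassumption; lra.
  - eapply ev_mul; eassumption.
Qed.

Lemma sums_to_scal rho tau u a c r x : 0 < rho -> Rabs c < tau ->
  sums_to rho tau a c r x -> sums_to rho tau (dscal u a) c r (u * x).
Proof.
  intros Hrho Hc [[A HA] <-]. pose proof (Rabs_pos c). split.
  - eexists. eapply dbounded_scal; try eassumption; lra.
  - apply ev_scal.
Qed.

Lemma sums_to_monom rho tau i j c r : 0 < rho -> Rabs c < tau ->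
  sums_to rho tau (dmonom i j) c r (r ^ i * c ^ j).
Proof.
  intros Hrho Hc. pose proof (Rabs_pos c). split.
  - eexists. apply dbounded_monom; lra.
  - apply ev_monom.
Qed.

Lemma dweight_INR_plus x a :
  dweight (fun k => INR k + x) a = dadd (dweight INR a) (dscal x a).
Proof.
  apply functional_extensionality; intros k; apply functional_extensionality; intros m.
  unfold dadd, dscal, dweight; ring.
Qed.

Lemma sums_to_weight_INR_plus rho rho' tau A x a c r : 0 < rho' < rho ->
  Rabs c < tau -> Rabs r < rho' -> dbounded rho tau A a ->
  sums_to rho' tau (dweight (fun k => INR k + x) a) c r (r * dev a c r + x * ev a c r).
Proof.
  intros Hrho Hc Hr HA. pose proof (Rabs_pos c). rewrite dweight_INR_plus.
  apply sums_to_add; [lra|assumption|assumption| |].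
  - split; [|apply ev_weight_INR]. eapply dbounded_weight_INR; [exact Hrho|lra|exact HA].
  - apply sums_to_scal; [lra|assumption|]. eapply sums_to_ev, dbounded_shrink; [| |exact HA]; lra.
Qed.

Lemma admissible_shrink rho rho' tau : 0 < rho' <= rho -> admissible rho tau ->
  admissible rho' tau.
Proof. intros Hr [H1 [H2 H3]]. split; [lra|split; [lra|nra]]. Qed.

Lemma dweight_cancel f a : (forall k, f k <> 0) ->
  dweight f (dweight (fun k => / f k) a) = a.
Proof.
  intros Hf. apply functional_extensionality; intros k.
  apply functional_extensionality; intros m. unfold dweight.
  rewrite <- Rmult_assoc, Rinv_r by apply Hf. ring.
Qed.

Lemma dweight_cancel_add f a b : (forall k, f k <> 0) ->
  dweight f (dadd (dweight (fun k => - / f k) a) (dweight (fun k => / f k) b)) =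
  dadd (dscal (-1) a) b.
Proof.
  intros Hf. apply functional_extensionality; intros k.
  apply functional_extensionality; intros m. unfold dadd, dscal, dweight.
  field. apply Hf.
Qed.

Lemma INR_plus_neq0 x k : 0 < x -> INR k + x <> 0.
Proof. intros Hx. pose proof (pos_INR k). lra. Qed.

Lemma q_series_eq :
  dweight (fun k => INR k + 2) q_series =
  dadd (dscal 2 (dmonom 1 0)) (dscal (-2) (dmul (dmonom 1 0) (dmul q_series q_series))).
Proof.
  transitivity (dweight (fun k => INR k + 2) (q_step q_series)).
  - f_equal. symmetry. exact (causal_fix_eq q_step q_step_causal).
  - apply dweight_cancel. intros k; apply INR_plus_neq0; lra.
Qed.

Lemma p_series_eq :
  let z := z_series in let x := p_series in let E := excess_series z in
  dweight (fun k => INR k + 3) p_series =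
  dadd (dscal (-1) (dmul (dweight (fun k => INR k + 1) x) E))
      (dadd
        (dscal (-2) (dadd (dmul z x)
           (dadd ww_series (dmul (dadd z x) (dadd x (dadd (dmul z x) ww_series))))))
        (dscal 4 (dmul rq_series
           (dmul (dadd (dmonom 0 0) (dadd z x)) (dadd (dmonom 0 0) E))))).
Proof.
  intros z x E. transitivity (dweight (fun k => INR k + 3) (p_step p_series)).
  - f_equal. symmetry. exact (causal_fix_eq p_step p_step_causal).
  - apply dweight_cancel_add. intros k; apply INR_plus_neq0; lra.
Qed.

Lemma dweight_INR_z : dweight INR z_series = p_series.
Proof.
  apply functional_extensionality; intros [|k].
  - transitivity null_row.
    + apply functional_extensionality; intros m. apply Rmult_0_l.
    + symmetry. apply (causal_fix_row_0 p_step p_step_causal).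
  - apply functional_extensionality; intros m. unfold z_series, dint, dweight.
    rewrite <- Rmult_assoc, Rinv_r; [ring|]. apply not_0_INR. lia.
Qed.

Lemma between_radii r rho : Rabs r < rho -> exists rho', Rabs r < rho' /\ 0 < rho' < rho.
Proof.
  intros Hr. exists ((Rabs r + rho) / 2). pose proof (Rabs_pos r). lra.
Qed.

Ltac sum_up :=
  repeat first
    [ eassumption
    | eapply sums_to_scal; [eassumption|eassumption|]
    | eapply sums_to_add; [eassumption|eassumption|eassumption| |]
    | eapply sums_to_mul; [eassumption|eassumption|eassumption| |]
    | eapply sums_to_monom; [eassumption|eassumption] ].

Lemma ev_rq rho tau c r : admissible rho tau -> Rabs c < tau -> Rabs r < rho ->
  sums_to rho tau rq_series c r (r * ev q_series c r).
Proof.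
  intros Had Hc Hr. pose proof Had as [[Hr0 Hr1] [Ht _]].
  assert (Hq : sums_to rho tau q_series c r (ev q_series c r)).
  { eapply sums_to_ev, q_series_bounded; lra. }
  replace (r * ev q_series c r) with (r ^ 1 * c ^ 0 * ev q_series c r) by ring.
  unfold rq_series. sum_up.
Qed.

Lemma q_equation rho tau c r : admissible rho tau -> Rabs c < tau -> Rabs r < rho ->
  let q := ev q_series c r in
  r * dev q_series c r = - 2 * q + 2 * r - 2 * r * q ^ 2.
Proof.
  intros Had Hc Hr q. destruct (between_radii r rho Hr) as [rho' [Hr' [H0 Hlt]]].
  pose proof Had as [[_ H1] [Ht _]].
  assert (HA : dbounded rho tau (2 * rho) q_series) by (apply q_series_bounded; lra).
  assert (Hq : sums_to rho' tau q_series c r q).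
  { eapply sums_to_ev, dbounded_shrink; [| |exact HA]; lra. }
  destruct (sums_to_weight_INR_plus rho rho' tau _ 2 q_series c r (conj H0 Hlt) Hc Hr' HA)
    as [_ HL].
  rewrite q_series_eq in HL. fold q in HL.
  assert (HR : exists x, x = 2 * r - 2 * r * q ^ 2 /\
    sums_to rho' tau (dadd (dscal 2 (dmonom 1 0))
      (dscal (-2) (dmul (dmonom 1 0) (dmul q_series q_series)))) c r x).
  { eexists. split; [|sum_up]. ring. }
  destruct HR as [x [Hx [_ HR]]]. lra.
Qed.

(** [p_series_eq] summed at [(c, r)]. The weights [INR k + 1] and [INR k + 3] turn
    into derivatives, which converge on a slightly smaller disc only. *)
Lemma p_equation rho tau c r : admissible rho tau -> Rabs c < tau -> Rabs r < rho ->
  let q := ev q_series c r in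
  let z := ev z_series c r in
  let p := ev p_series c r in
  let E := 2 * z + z ^ 2 - c ^ 2 * q ^ 2 in
  let B := 2 * c ^ 2 * r * q * (1 - q ^ 2) in
  r * dev p_series c r + 3 * p =
  - ((r * dev p_series c r + p) * E)
  - 2 * (z * p + B + (z + p) * (p + z * p + B))
  + 4 * (r * q) * (1 + z + p) * (1 + E).
Proof.
  intros Had Hc Hr q z p E B. destruct (between_radii r rho Hr) as [rho' [Hr' [H0 Hlt]]].
  pose proof Had as [[_ H1] [Ht _]].
  assert (Had' : admissible rho' tau) by (apply (admissible_shrink rho); [lra|exact Had]).
  assert (HA : dbounded rho tau (1 / 10) p_series) by (apply p_series_bounded, Had).
  assert (Hp : sums_to rho' tau p_series c r p).
  { eapply sums_to_ev, p_series_bounded, Had'. }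
  assert (Hz : sums_to rho' tau z_series c r z).
  { eapply sums_to_ev, z_series_bounded, Had'. }
  assert (Hq : sums_to rho' tau q_series c r q).
  { eapply sums_to_ev, q_series_bounded; lra. }
  pose proof (ev_rq rho' tau c r Had' Hc Hr') as Hrq. fold q in Hrq.
  assert (HE : exists x, x = E /\ sums_to rho' tau (excess_series z_series) c r x).
  { eexists. split; [|unfold excess_series, w2_series; sum_up]. unfold E; ring. }
  destruct HE as [x [-> HE]].
  assert (HB : exists x, x = B /\ sums_to rho' tau ww_series c r x).
  { eexists. split; [|unfold ww_series; sum_up]. unfold B; ring. }
  destruct HB as [x [-> HB]].
  destruct (sums_to_weight_INR_plus rho rho' tau _ 3 p_series c r (conj H0 Hlt) Hc Hr' HA)
    as [_ HL].
  pose proof (sums_to_weight_INR_plus rho rho' tau _ 1 p_series c r (conj H0 Hlt) Hc Hr' HA)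
    as Hp1. fold p in HL, Hp1.
  rewrite p_series_eq in HL. rewrite <- HL.
  match goal with |- ev ?a c r = ?rhs =>
    assert (HR : exists x, x = rhs /\ sums_to rho' tau a c r x) end.
  { eexists. split; [|cbv zeta; sum_up]. ring. }
  destruct HR as [x [<- [_ HR]]]. exact HR.
Qed.

Lemma ev_p_dev_z c r : ev p_series c r = r * dev z_series c r.
Proof. rewrite <- dweight_INR_z. apply ev_weight_INR. Qed.

(** * The coefficient [r * coth (2 * r)] *)

Lemma is_derive_sinh2 r : is_derive (fun r => sinh (2 * r)) r (2 * cosh (2 * r)).
Proof. unfold sinh, cosh. auto_derive; [exact I|]. field. Qed.

Lemma is_derive_cosh2 r : is_derive (fun r => cosh (2 * r)) r (2 * sinh (2 * r)).
Proof. unfold sinh, cosh. auto_derive; [exact I|]. field. Qed.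

(** The difference [f] of the two sides solves [f' = - 2 * q * f] because of the
    Riccati equation, and [f 0 = 0]. *)
Lemma cosh_sinh_q rho tau c r : admissible rho tau -> Rabs c < tau -> Rabs r < rho ->
  r * cosh (2 * r) = sinh (2 * r) * (1 / 2 + r * ev q_series c r).
Proof.
  intros Had Hc Hr. pose proof Had as [[H0 H1] [Ht _]].
  assert (HA : dbounded rho tau (2 * rho) q_series) by (apply q_series_bounded; lra).
  set (q := ev q_series c).
  set (Q := PSeries (PS_Int (rowsum q_series c))).
  assert (HQ : forall t, Rabs t < rho -> is_derive Q t (q t)).
  { intros t Htr. unfold q, ev.
    rewrite (PSeries_ext _ (PS_derive (PS_Int (rowsum q_series c)))).
    - apply is_derive_PSeries. rewrite CV_radius_Int.
      eapply rowsum_CV_radius; eassumption.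
    - intros n. unfold PS_derive, PS_Int. field. apply not_0_INR; lia. }
  set (h := fun t => (sinh (2 * t) * (1 / 2 + t * q t) - t * cosh (2 * t)) * exp (2 * Q t)).
  assert (Hh : forall t, Rabs t < rho -> is_derive h t 0).
  { intros t Htr.
    pose proof (is_derive_ev rho tau _ q_series c t HA Hc Htr) as Hq'. fold q in Hq'.
    pose proof (HQ t Htr) as HQ'.
    set (sh := fun t => sinh (2 * t)). set (ch := fun t => cosh (2 * t)).
    pose proof (is_derive_sinh2 t : is_derive sh t (2 * ch t)) as Hs.
    pose proof (is_derive_cosh2 t : is_derive ch t (2 * sh t)) as Hch.
    change (is_derive (fun t => (sh t * (1 / 2 + t * q t) - t * ch t) * exp (2 * Q t)) t 0).
    auto_derive.
    - repeat split; try (eexists; eassumption).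
    - rewrite (is_derive_unique (fun x : R => q x) _ _ Hq'),
        (is_derive_unique (fun x : R => Q x) _ _ HQ'),
        (is_derive_unique (fun x : R => sh x) _ _ Hs),
        (is_derive_unique (fun x : R => ch x) _ _ Hch).
      pose proof (q_equation rho tau c t Had Hc Htr) as Hric. cbv zeta in Hric.
      change (ev q_series c t) with (q t) in Hric.
      match goal with |- ?u = 0 => replace u with
        ((sh t * (t * dev q_series c t - (- 2 * q t + 2 * t - 2 * t * q t ^ 2)))
           * exp (2 * Q t)) by field end.
      rewrite Hric. ring. }
  assert (Hh0 : h 0 = 0).
  { unfold h. rewrite Rmult_0_r, sinh_0. ring. }
  assert (Hhr : h r = 0).
  { rewrite <- Hh0. destruct (Rtotal_order r 0) as [Hneg|[->|Hpos]].
    - apply (eq_is_derive h r 0); [|exact Hneg]. intros t Htt. apply Hh.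
      rewrite Rabs_left in Hr by lra. apply Rabs_def1; lra.
    - reflexivity.
    - symmetry. apply (eq_is_derive h 0 r); [|exact Hpos]. intros t Htt. apply Hh.
      rewrite Rabs_right in Hr by lra. apply Rabs_def1; lra. }
  unfold h in Hhr. apply Rmult_integral in Hhr. destruct Hhr as [Hhr|Hhr].
  - lra.
  - pose proof (exp_pos (2 * Q r)). lra.
Qed.

Lemma sinh_neq0 x : x <> 0 -> sinh x <> 0.
Proof.
  intros Hx. unfold sinh. intros H.
  assert (He : exp x = exp (- x)) by lra. apply exp_inv in He. lra.
Qed.

Lemma coth_q rho tau c r : admissible rho tau -> Rabs c < tau -> Rabs r < rho ->
  r <> 0 -> r * coth (2 * r) = 1 / 2 + r * ev q_series c r.
Proof.
  intros Had Hc Hr Hr0. unfold coth, Rdiv at 1.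
  rewrite <- Rmult_assoc, (cosh_sinh_q rho tau c r Had Hc Hr).
  field. apply sinh_neq0. lra.
Qed.

Lemma w_q rho tau c r : admissible rho tau -> Rabs c < tau -> Rabs r < rho ->
  w c r = c * (r * ev q_series c r).
Proof.
  intros Had Hc Hr. unfold w. destruct (Req_EM_T r 0) as [->|Hr0]; [ring|].
  rewrite (coth_q rho tau c r Had Hc Hr Hr0). ring.
Qed.

(** * The equation in terms of [v / r] *)

(** The value at [r] of the equation, cleared of denominators, for
    [v = r * y], where [p = r * y'] and [s = r * p']. *)
Definition reduced (c q r y p s : R) : R :=
  (s + p) * (y ^ 2 - c ^ 2 * q ^ 2)
  + 2 * (y + p) * (y * p + 2 * c ^ 2 * r * q * (1 - q ^ 2))
  - 4 * (r * q) * (y + p) * (y ^ 2 - c ^ 2 * q ^ 2).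

(** [r * (y ^ 2 - c ^ 2 * q ^ 2)] is the common denominator, once [q'] and
    [coth] are eliminated. *)
Lemma reduced_ode c q q1 r y p y1 p1 K :
  r <> 0 -> p = r * y1 -> r * q1 = - 2 * q + 2 * r - 2 * r * q ^ 2 ->
  r * K = 1 / 2 + r * q -> y ^ 2 - c ^ 2 * q ^ 2 <> 0 ->
  reduced c q r y p (r * p1) =
  (y1 + p1
   + 2 * (y + p)
     * ((r * y * (y + p) + c * (r * q) * (c * (q + r * q1)))
        / ((r * y) ^ 2 - (c * (r * q)) ^ 2))
   - 4 * (y + p) * K) * (r * (y ^ 2 - c ^ 2 * q ^ 2)).
Proof.
  intros Hr Hp Hq HK HD.
  replace y1 with (p / r) by (rewrite Hp; field; exact Hr).
  replace K with ((1 / 2 + r * q) / r) by (rewrite <- HK; field; exact Hr).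
  replace q1 with ((- 2 * q + 2 * r - 2 * r * q ^ 2) / r) by (rewrite <- Hq; field; exact Hr).
  unfold reduced. field.
  repeat split; try assumption.
  intros H. apply HD. apply (Rmult_eq_reg_l (r ^ 2)); [|apply pow_nonzero, Hr].
  rewrite Rmult_0_r, <- H. ring.
Qed.

Lemma locally_Rabs_lt (x e : R) : Rabs x < e -> locally x (fun y => Rabs y < e).
Proof.
  intros Hx. exists (mkposreal (e - Rabs x) (proj2 (Rlt_0_minus _ _) Hx)). intros y Hy.
  change (Rabs (y - x) < e - Rabs x) in Hy.
  pose proof (Rabs_triang_inv y x) as H. lra.
Qed.

Lemma derive_radial (e : R) (u y p y1 p1 : R -> R) :
  (forall t, Rabs t < e -> u t = t * y t) ->
  (forall t, Rabs t < e -> p t = t * y1 t) ->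
  (forall t, Rabs t < e -> is_derive y t (y1 t)) ->
  (forall t, Rabs t < e -> is_derive p t (p1 t)) ->
  forall t, Rabs t < e ->
    Derive u t = y t + p t /\ Derive_n u 2 t = y1 t + p1 t.
Proof.
  intros Hu Hp Hy Hp1.
  assert (H1 : forall t, Rabs t < e -> Derive u t = y t + p t).
  { intros t Ht. rewrite (Derive_ext_loc u (fun t => t * y t)).
    - apply is_derive_unique. rewrite Hp by exact Ht.
      pose proof (Hy t Ht) as Hyt.
      auto_derive; [eexists; eassumption|].
      rewrite (is_derive_unique (fun x : R => y x) _ _ Hyt). ring.
    - apply (filter_imp (fun y => Rabs y < e)); [exact Hu|apply locally_Rabs_lt, Ht]. }
  intros t Ht. split; [apply H1, Ht|].
  change (Derive (Derive u) t = y1 t + p1 t).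
  rewrite (Derive_ext_loc (Derive u) (fun t => y t + p t)).
  - apply is_derive_unique, (is_derive_plus (V := R_NormedModule)); auto.
  - apply (filter_imp (fun y => Rabs y < e)); [exact H1|apply locally_Rabs_lt, Ht].
Qed.

Lemma derive_w rho tau c r : admissible rho tau -> Rabs c < tau -> Rabs r < rho ->
  Derive (w c) r = c * (ev q_series c r + r * dev q_series c r).
Proof.
  intros Had Hc Hr. pose proof Had as [[H0 H1] [Ht _]].
  assert (HA : dbounded rho tau (2 * rho) q_series) by (apply q_series_bounded; lra).
  rewrite (Derive_ext_loc (w c) (fun t => c * (t * ev q_series c t))).
  - pose proof (is_derive_ev rho tau _ q_series c r HA Hc Hr) as Hq.
    set (q := ev q_series c) in *. change (ev q_series c r) with (q r).
    apply is_derive_unique. auto_derive; [eexists; eassumption|].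
    rewrite (is_derive_unique (fun x : R => q x) _ _ Hq). ring.
  - apply (filter_imp (fun y => Rabs y < rho)); [|apply locally_Rabs_lt, Hr].
    intros t Htr. apply (w_q rho tau); assumption.
Qed.

(** Read from right to left this gives existence; read from left to right it
    puts an arbitrary solution in the form to which uniqueness applies. *)
Lemma ode_iff_reduced rho tau c r u y p y1 p1 :
  admissible rho tau -> Rabs c < tau -> Rabs r < rho -> r <> 0 ->
  u r = r * y -> p = r * y1 -> Derive u r = y + p -> Derive_n u 2 r = y1 + p1 ->
  let q := ev q_series c r in
  (u r ^ 2 - w c r ^ 2 <> 0 /\
     Derive_n u 2 r
     + 2 * Derive u r
       * ((u r * Derive u r + w c r * Derive (w c) r)
          / (u r ^ 2 - w c r ^ 2))
     - 4 * Derive u r * coth (2 * r) = 0) <->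
  (y ^ 2 - c ^ 2 * q ^ 2 <> 0 /\ reduced c q r y p (r * p1) = 0).
Proof.
  intros Had Hc Hr Hr0 Hu Hp H1 H2 q.
  pose proof (q_equation rho tau c r Had Hc Hr) as Hq. cbv zeta in Hq. fold q in Hq.
  pose proof (coth_q rho tau c r Had Hc Hr Hr0) as HK. fold q in HK.
  rewrite H1, H2, Hu, (derive_w rho tau c r Had Hc Hr), (w_q rho tau c r Had Hc Hr).
  fold q.
  assert (HD : (r * y) ^ 2 - (c * (r * q)) ^ 2 = r ^ 2 * (y ^ 2 - c ^ 2 * q ^ 2)) by ring.
  pose proof (pow_nonzero r 2 Hr0) as Hr2.
  split; intros [Hne Heq].
  - assert (HD' : y ^ 2 - c ^ 2 * q ^ 2 <> 0).
    { intros H. apply Hne. rewrite HD, H. ring. }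
    split; [exact HD'|].
    rewrite (reduced_ode c q _ r y p y1 p1 _ Hr0 Hp Hq HK HD'), Heq. ring.
  - split.
    + rewrite HD. apply Rmult_integral_contrapositive_currified; assumption.
    + rewrite (reduced_ode c q _ r y p y1 p1 _ Hr0 Hp Hq HK Hne) in Heq.
      apply Rmult_integral in Heq. destruct Heq as [Heq|Heq]; [exact Heq|].
      apply Rmult_integral in Heq. destruct Heq; contradiction.
Qed.

(** * Existence and analyticity *)

Definition v_series : nat -> nat -> R :=
  dmul (dmonom 1 0) (dadd (dmonom 0 0) z_series).

Lemma v_series_bounded rho tau : admissible rho tau ->
  exists A, dbounded rho tau A v_series.
Proof.
  intros Had. pose proof Had as [[H0 H1] [Ht _]].
  eexists. eapply dbounded_mul; [lra|lra|apply dbounded_monom; lra|].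
  eapply dbounded_add; [lra|lra|apply dbounded_monom; lra|].
  apply z_series_bounded, Had.
Qed.

Lemma ev_v rho tau c r : admissible rho tau -> Rabs c < tau -> Rabs r < rho ->
  ev v_series c r = r * (1 + ev z_series c r).
Proof.
  intros Had Hc Hr. pose proof Had as [[H0 H1] [Ht _]].
  assert (Hz : sums_to rho tau z_series c r (ev z_series c r)).
  { eapply sums_to_ev, z_series_bounded, Had. }
  assert (HR : exists x, x = r * (1 + ev z_series c r) /\ sums_to rho tau v_series c r x).
  { eexists. split; [|unfold v_series; sum_up]. ring. }
  destruct HR as [x [<- [_ HR]]]. exact HR.
Qed.

Lemma analytic_at_PSeries w A (a : nat -> R) x :
  (forall N, wnorm w N a <= A) -> Rabs x < w -> analytic_at (PSeries a) x.
Proof.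
  intros HA Hx. exists (recenter x a).
  assert (He : 0 < w - Rabs x) by lra.
  exists (mkposreal _ He). intros y Hy. change (Rabs (y - x) < w - Rabs x) in Hy.
  apply is_pseries_R.
  pose proof (recenter_is_series x (w - Rabs x) A a (y - x)) as H.
  replace (x + (y - x)) with (y : R) in H by (symmetry; apply Rplus_minus). apply H; [lra| |lra].
  intros N. replace (Rabs x + (w - Rabs x)) with w by ring. apply HA.
Qed.

(** Each row is expanded about [c0], within the distance [1]; the norms of the
    new rows are no larger, and the order of summation can be exchanged. *)
Lemma analytic2_ev rho A a c0 : 0 < rho -> dbounded rho (Rabs c0 + 1) A a ->
  analytic2_at (ev a) c0 0.
Proof.
  intros Hrho HA. pose proof (Rabs_pos c0) as Hc0.
  exists (fun m n => recenter c0 (a n) m), (Rmin 1 rho).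
  split; [apply Rmin_pos; lra|].
  intros x y Hx Hy. rewrite Rminus_0_r in Hy.
  pose proof (Rmin_l 1 rho). pose proof (Rmin_r 1 rho).
  rewrite Rminus_0_r. set (t := x - c0) in *.
  assert (Hs : Rabs (Rabs c0 + 1) <= Rabs c0 + 1) by (rewrite Rabs_pos_eq; lra).
  assert (Hrr : Rabs rho <= rho) by (rewrite Rabs_pos_eq; lra).
  pose proof (dbounded_terms _ _ _ _ _ _ HA Hs Hrr) as Hterms.
  destruct (abs_sums_le_rows _ _ Hterms) as [HS1 HS2].
  set (S_ := fun n => Series (fun i => Rabs (a n i) * (Rabs c0 + 1) ^ i)).
  assert (HSex : forall n, ex_series (fun i => Rabs (a n i) * (Rabs c0 + 1) ^ i)).
  { intros n. pose proof (abs_sums_le_row _ _ n Hterms) as He.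
    apply (ex_series_ext (fun i => Rabs (a n i * (Rabs c0 + 1) ^ i * rho ^ n) * / rho ^ n)).
    - intros i. rewrite !Rabs_mult, <- !RPow_abs, (Rabs_pos_eq rho),
        (Rabs_pos_eq (Rabs c0 + 1)) by lra.
      match goal with |- @eq _ ?x ?y => change (@eq R x y) end.
      field. apply pow_nonzero; lra.
    - apply ex_series_scal_r, He. }
  assert (HSrho : forall n,
    Series (fun i => Rabs (a n i * (Rabs c0 + 1) ^ i * rho ^ n)) = S_ n * rho ^ n).
  { intros n. unfold S_. rewrite <- Series_scal_r. apply Series_ext. intros i.
    rewrite !Rabs_mult, <- !RPow_abs, (Rabs_pos_eq rho), (Rabs_pos_eq (Rabs c0 + 1)) by lra.
    reflexivity. }
  assert (HSpos : forall n, 0 <= S_ n).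
  { intros n. eapply Rle_trans; [|apply (sum_f_R0_le_Series _ 0); [|apply HSex]].
    - apply cond_pos_sum. intros; apply Rmult_le_pos; [apply Rabs_pos|apply pow_le; lra].
    - intros; apply Rmult_le_pos; [apply Rabs_pos|apply pow_le; lra]. }
  assert (Hpart : forall n N,
    sum_f_R0 (fun i => Rabs (a n i) * (Rabs c0 + 1) ^ i) N <= S_ n).
  { intros n N. apply sum_f_R0_le_Series; [|apply HSex].
    intros; apply Rmult_le_pos; [apply Rabs_pos|apply pow_le; lra]. }
  assert (Habs : abs_sums_le (fun n m => recenter c0 (a n) m * t ^ m * y ^ n) A).
  { intros K M. apply Rle_trans with (sum_f_R0 (fun n => S_ n * rho ^ n) K).
    - apply sum_Rle. intros n _.
      apply Rle_trans with
        (sum_f_R0 (fun m => Rabs (recenter c0 (a n) m) * 1 ^ m) M * rho ^ n).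
      + rewrite Rmult_comm, scal_sum. apply sum_Rle. intros m _.
        rewrite !Rabs_mult, <- !RPow_abs.
        pose proof (Rabs_pos t). pose proof (Rabs_pos y).
        apply Rmult_le_compat.
        * apply Rmult_le_pos; [apply Rabs_pos|apply pow_le; lra].
        * apply pow_le; lra.
        * apply Rmult_le_compat_l; [apply Rabs_pos|apply pow_incr; lra].
        * apply pow_incr; lra.
      + apply Rmult_le_compat_r; [apply pow_le; lra|].
        apply recenter_bound; [lra|apply Hpart].
    - eapply Rle_trans; [|exact HS2].
      rewrite (sum_eq _ (fun n => Series (fun i =>
        Rabs (a n i * (Rabs c0 + 1) ^ i * rho ^ n)))).
      + apply sum_f_R0_le_Series; [|exact HS1]. intros n. rewrite HSrho.
        apply Rmult_le_pos; [apply HSpos|apply pow_le; lra].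
      + intros n _. symmetry. apply HSrho. }
  pose proof (abs_sums_le_swap _ _ Habs) as Hswap.
  split; [|split].
  - intros m. exact (abs_sums_le_row _ _ m Hswap).
  - exact (proj1 (abs_sums_le_rows _ _ Hswap)).
  - replace (ev a x y) with
      (Series (fun n => Series (fun m => recenter c0 (a n) m * t ^ m * y ^ n))).
    + exact (fubini_series _ _ Hswap).
    + unfold ev. rewrite PSeries_Series. apply Series_ext. intros n.
      rewrite Series_scal_r. f_equal. unfold rowsum.
      rewrite PSeries_Series. replace x with (c0 + t) by (unfold t; ring).
      apply is_series_unique, (recenter_is_series c0 1 (S_ n)); [lra|apply Hpart|lra].
Qed.

(** [v ^ 2 - w ^ 2 = r ^ 2 * (1 + E)] does not vanish for [r <> 0], because the
    norm of [E] is at most [22 / 100]. *)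
Lemma v_solution rho tau c : admissible rho tau -> Rabs c < tau ->
  solution_on c rho (ev v_series c).
Proof.
  intros Had Hc. pose proof Had as [[H0 H1] [Ht _]].
  destruct (v_series_bounded rho tau Had) as [A HA].
  pose proof (z_series_bounded rho tau Had) as Hz.
  pose proof (p_series_bounded rho tau Had) as Hp.
  assert (Hder : forall t, Rabs t < rho ->
     Derive (ev v_series c) t = 1 + ev z_series c t + ev p_series c t /\
     Derive_n (ev v_series c) 2 t = dev z_series c t + dev p_series c t).
  { apply (derive_radial rho _ (fun t => 1 + ev z_series c t)).
    - intros t Htr. apply (ev_v rho tau); assumption.
    - intros t _. apply ev_p_dev_z.
    - intros t Htr. rewrite <- (Rplus_0_l (dev z_series c t)).
      apply (is_derive_plus (V := R_NormedModule) (fun _ => 1)).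
      + apply (is_derive_const (V := R_NormedModule)).
      + eapply is_derive_ev; eassumption.
    - intros t Htr. eapply is_derive_ev; eassumption. }
  assert (Hrho0 : Rabs 0 < rho) by (rewrite Rabs_R0; lra).
  split; [|split; [|split]].
  - intros r Hr. apply (analytic_at_PSeries rho A); [|exact Hr].
    intros N. apply (rowsum_wnorm rho tau); [lra|exact HA|lra].
  - rewrite (ev_v rho tau c 0 Had Hc Hrho0). ring.
  - rewrite (proj1 (Hder 0 Hrho0)). unfold ev. rewrite !PSeries_0. unfold rowsum.
    rewrite (PSeries_ext (p_series 0%nat) null_row), (PSeries_ext (z_series 0%nat) null_row).
    + rewrite (PSeries_const_0 c : PSeries null_row c = 0). ring.
    + intros n. unfold z_series, dint. rewrite weight_row_0; [reflexivity|].
      apply (causal_fix_row_0 p_step p_step_causal).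
    + intros n. unfold p_series. rewrite causal_fix_row_0; [reflexivity|apply p_step_causal].
  - intros r Hr Hr0.
    apply (ode_iff_reduced rho tau c r (ev v_series c) (1 + ev z_series c r)
      (ev p_series c r) (dev z_series c r) (dev p_series c r) Had Hc Hr Hr0).
    + apply (ev_v rho tau); assumption.
    + apply ev_p_dev_z.
    + apply Hder, Hr.
    + apply Hder, Hr.
    + set (q := ev q_series c r). set (z := ev z_series c r).
      assert (HE : sums_to rho tau (excess_series z_series) c r
                (2 * z + z ^ 2 - c ^ 2 * q ^ 2)).
      { assert (Hz' : sums_to rho tau z_series c r z) by (eapply sums_to_ev, Hz).
        assert (Hq : sums_to rho tau q_series c r q).
        { eapply sums_to_ev, q_series_bounded; lra. }
        assert (HR : exists x, x = 2 * z + z ^ 2 - c ^ 2 * q ^ 2 /\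
          sums_to rho tau (excess_series z_series) c r x).
        { eexists. split; [|unfold excess_series, w2_series; sum_up]. ring. }
        destruct HR as [x [<- HR]]. exact HR. }
      pose proof (ev_bound rho tau _ _ c r (excess_bounded rho tau _ Had Hz) Hc Hr) as Hb.
      rewrite (proj2 HE) in Hb. apply Rabs_le_between in Hb.
      split.
      * intros H. lra.
      * pose proof (p_equation rho tau c r Had Hc Hr) as Heq. cbv zeta in Heq.
        fold q z in Heq. unfold reduced. lra.
Qed.

(** * Uniqueness *)

Lemma ex_pseries_CV_radius (a : nat -> R) (s t : R) :
  ex_pseries a s -> Rabs t < Rabs s -> Rbar_lt (Rabs t) (CV_radius a).
Proof.
  intros Hs Hts. apply Rbar_lt_le_trans with (Rabs s); [exact Hts|].
  apply Rbar_not_lt_le. intros H. apply (CV_disk_outside a s H).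
  exact (ex_series_lim_0 _ (proj1 (ex_pseries_R a s) Hs)).
Qed.

Lemma CV_radius_decr_n (a : nat -> R) (n : nat) : CV_radius (PS_decr_n a n) = CV_radius a.
Proof.
  induction n as [|n IH]; [reflexivity|].
  rewrite <- IH, <- (CV_radius_decr_1 (PS_decr_n a n)).
  apply CV_radius_ext. intros k. unfold PS_decr_n, PS_decr_1. f_equal. lia.
Qed.

(** A continuity statement; differentiability is the form in which continuity of
    the functions at hand is obtained. *)
Lemma accumulating_zeros (h : R -> R) :
  ex_derive h 0 -> (forall d, 0 < d -> exists t, Rabs t < d /\ h t = 0) -> h 0 = 0.
Proof.
  intros Hh Hz. destruct (Req_dec (h 0) 0) as [H|H]; [exact H|exfalso].
  assert (Hl : locally 0 (fun t => h t <> 0)).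
  { exact (ex_derive_continuous (V := R_NormedModule) h 0 Hh (fun y => y <> 0)
      (open_neq 0 (h 0) H)). }
  destruct Hl as [d Hd]. destruct (Hz d (cond_pos d)) as [t [Ht Ht0]].
  apply (Hd t); [|exact Ht0].
  change (Rabs (t - 0) < d). rewrite Rminus_0_r. exact Ht.
Qed.

Lemma ex_derive_PSeries_0 (a : nat -> R) : Rbar_lt 0 (CV_radius a) -> ex_derive (PSeries a) 0.
Proof. intros H. apply ex_derive_PSeries. rewrite Rabs_R0. exact H. Qed.

Lemma analytic_at_PS f x : analytic_at f x ->
  exists (a : nat -> R) (d : R), 0 < d /\
    (forall t, Rabs t < d -> Rbar_lt (Rabs t) (CV_radius a)) /\
    (forall t, Rabs t < d -> f (x + t) = PSeries a t).
Proof.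
  intros [a [d Hd]]. exists a, d.
  assert (Hs : forall t, Rabs t < d -> is_pseries a t (f (x + t))).
  { intros t Ht. specialize (Hd (x + t)).
    replace (x + t - x) with t in Hd by ring. apply Hd.
    change (Rabs (x + t - x) < d). replace (x + t - x) with t by ring. exact Ht. }
  split; [apply cond_pos|split].
  - intros t Ht. destruct (between_radii t d Ht) as [s [Hts Hsd]].
    apply (ex_pseries_CV_radius a s).
    + eexists. apply Hs. rewrite Rabs_pos_eq; lra.
    + rewrite (Rabs_pos_eq s); lra.
  - intros t Ht. symmetry. apply is_pseries_unique, Hs, Ht.
Qed.

(** A first nonzero coefficient [a n] would be the limit of [f (x + t) / t ^ n]
    at [0], but this quotient has zeros accumulating there. *)
Lemma analytic_zeros f x : analytic_at f x ->
  (forall d, 0 < d -> exists t, t <> 0 /\ Rabs t < d /\ f (x + t) = 0) ->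
  exists d, 0 < d /\ forall t, Rabs t < d -> f (x + t) = 0.
Proof.
  intros Hf Hz. destruct (analytic_at_PS f x Hf) as [a [d [Hd [HCV Ha]]]].
  exists d. split; [exact Hd|].
  assert (Ha0 : forall n, a n = 0).
  { intros n. induction n as [n IH] using lt_wf_ind.
    replace (a n) with (PSeries (PS_decr_n a n) 0)
      by (rewrite PSeries_0; unfold PS_decr_n; f_equal; lia).
    apply accumulating_zeros.
    - apply ex_derive_PSeries_0. rewrite CV_radius_decr_n.
      rewrite <- Rabs_R0. apply HCV. rewrite Rabs_R0. exact Hd.
    - intros d' Hd'. destruct (Hz (Rmin d d')) as [t [Ht0 [Ht Hft]]]; [apply Rmin_pos; assumption|].
      pose proof (Rmin_l d d'). pose proof (Rmin_r d d').
      exists t. split; [lra|].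
      rewrite Ha, (PSeries_decr_n_aux a n t IH) in Hft by lra.
      apply Rmult_integral in Hft. destruct Hft as [Hft|Hft]; [|exact Hft].
      exfalso. exact (pow_nonzero t n Ht0 Hft). }
  intros t Ht. rewrite Ha by exact Ht.
  rewrite (PSeries_ext a (fun _ => 0)) by exact Ha0. apply PSeries_const_0.
Qed.

Lemma analytic_at_minus f g x : analytic_at f x -> analytic_at g x ->
  analytic_at (fun y => f y - g y) x.
Proof.
  intros [a Ha] [b Hb]. exists (PS_minus a b).
  generalize (filter_and _ _ Ha Hb). apply filter_imp. intros y [H1 H2].
  exact (is_pseries_minus (V := R_NormedModule) a b (y - x) _ _ H1 H2).
Qed.

(** The supremum of the [s] such that [f] vanishes on [[0, s * r]] is reached,
    and cannot be less than [1] since zeros accumulate there. *)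
Lemma identity_theorem f e :
  (forall r, Rabs r < e -> analytic_at f r) ->
  (exists d, 0 < d /\ forall t, Rabs t < d -> f t = 0) ->
  forall r, Rabs r < e -> f r = 0.
Proof.
  intros Hf [d0 [Hd0 H0]] r Hr.
  destruct (Req_dec r 0) as [->|Hr0].
  { apply H0. rewrite Rabs_R0. exact Hd0. }
  pose proof (Rabs_pos_lt r Hr0) as Hrpos.
  set (S_ := fun s => 0 <= s <= 1 /\ forall t, 0 <= t <= s -> f (t * r) = 0).
  assert (Hadd : forall m d, 0 <= m <= 1 -> 0 < d ->
    (forall t, 0 <= t < m -> f (t * r) = 0) ->
    (forall t, Rabs t < d -> f (m * r + t) = 0) -> S_ (Rmin 1 (m + d / (2 * Rabs r)))).
  { intros m d Hm Hd Hbelow Hnear.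
    assert (Hdr : 0 < d / (2 * Rabs r)) by (apply Rdiv_lt_0_compat; lra).
    split.
    - split; [apply Rmin_glb; lra|apply Rmin_l].
    - intros t [Ht0 Ht]. destruct (Rlt_dec t m) as [Htm|Htm]; [apply Hbelow; lra|].
      replace (t * r) with (m * r + (t - m) * r) by ring. apply Hnear.
      rewrite Rabs_mult, Rabs_pos_eq by lra.
      pose proof (Rmin_r 1 (m + d / (2 * Rabs r))).
      apply Rle_lt_trans with (d / (2 * Rabs r) * Rabs r).
      + apply Rmult_le_compat_r; lra.
      + replace (d / (2 * Rabs r) * Rabs r) with (d / 2) by (field; lra). lra. }
  assert (HS0 : S_ (Rmin 1 (0 + d0 / (2 * Rabs r)))).
  { apply (Hadd 0 d0); try lra.
    - intros t Ht; lra.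
    - intros t Ht. replace (0 * r + t) with t by ring. apply H0, Ht. }
  destruct (completeness S_) as [m [Hub Hleast]].
  { exists 1. intros s [Hs _]. lra. }
  { eexists; exact HS0. }
  assert (Hm0 : 0 < m).
  { eapply Rlt_le_trans; [|apply Hub, HS0]. apply Rmin_pos; [lra|].
    pose proof (Rdiv_lt_0_compat d0 (2 * Rabs r)). lra. }
  assert (Hm1 : m <= 1) by (apply Hleast; intros s [Hs _]; lra).
  assert (Hbelow : forall t, 0 <= t < m -> f (t * r) = 0).
  { intros t Ht. apply NNPP. intros Hne.
    assert (m <= t); [|lra]. apply Hleast. intros s [Hs Hsz].
    destruct (Rle_dec s t) as [Hst|Hst]; [exact Hst|]. exfalso. apply Hne, Hsz. lra. }
  destruct (analytic_zeros f (m * r)) as [d [Hd Hnear]].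
  - apply Hf. rewrite Rabs_mult, (Rabs_pos_eq m) by lra. nra.
  - intros d Hd.
    set (s := Rmin m (d / (2 * Rabs r))).
    assert (Hs : 0 < s) by (apply Rmin_pos; [lra|apply Rdiv_lt_0_compat; lra]).
    assert (Hs1 : s <= m) by apply Rmin_l.
    assert (Hs2 : s <= d / (2 * Rabs r)) by apply Rmin_r.
    exists (- s * r). split; [|split].
    + apply Rmult_integral_contrapositive_currified; lra.
    + rewrite Rabs_mult, Rabs_Ropp, (Rabs_pos_eq s) by lra.
      apply Rle_lt_trans with (d / (2 * Rabs r) * Rabs r).
      * apply Rmult_le_compat_r; lra.
      * replace (d / (2 * Rabs r) * Rabs r) with (d / 2) by (field; lra). lra.
    + replace (m * r + - s * r) with ((m - s) * r) by ring. apply Hbelow. lra.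
  - pose proof (Hadd m d (conj (Rlt_le _ _ Hm0) Hm1) Hd Hbelow Hnear) as HSm.
    pose proof (Hub _ HSm) as Hle.
    assert (Hdr : 0 < d / (2 * Rabs r)) by (apply Rdiv_lt_0_compat; lra).
    destruct HSm as [_ HSm]. unfold Rmin in *.
    destruct (Rle_dec 1 (m + d / (2 * Rabs r))); [|lra].
    replace r with (1 * r) by ring. apply HSm. lra.
Qed.

(** The effect of [t * d/dt] on the coefficients. *)
Definition euler (b : nat -> R) (n : nat) : R := INR n * b n.

Lemma euler_incr_derive b n : euler b n = PS_incr_1 (PS_derive b) n.
Proof. destruct n; [apply Rmult_0_l|reflexivity]. Qed.

Lemma CV_radius_euler b : CV_radius (euler b) = CV_radius b.
Proof.
  rewrite (CV_radius_ext _ _ (euler_incr_derive b)), CV_radius_incr_1. apply CV_radius_derive.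
Qed.

Lemma PSeries_euler b t : PSeries (euler b) t = t * PSeries (PS_derive b) t.
Proof. rewrite (PSeries_ext _ _ t (euler_incr_derive b)). apply PSeries_incr_1. Qed.

(** [b] is the Taylor series of [v / r] for a solution [v], on a disc of radius [d]. *)
Definition solution_coefs (c d : R) (b : nat -> R) : Prop :=
  0 < d /\ b 0%nat = 1 /\
  (forall t, Rabs t < d -> Rbar_lt (Rabs t) (CV_radius b)) /\
  (forall t, Rabs t < d -> t <> 0 ->
     reduced c (ev q_series c t) t (PSeries b t) (PSeries (euler b) t)
       (PSeries (euler (euler b)) t) = 0).

Lemma admissible_radius c : admissible (/ (20 * (Rabs c + 1))) (Rabs c + 1).
Proof.
  pose proof (Rabs_pos c).
  assert (H20 : / (20 * (Rabs c + 1)) * (Rabs c + 1) = 1 / 20) by (field; lra).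
  assert (Hpos : 0 < / (20 * (Rabs c + 1))) by (apply Rinv_0_lt_compat; lra).
  split; [split; [exact Hpos|nra]|split; lra].
Qed.

Lemma solution_coefs_of_solution c e u : 0 < e -> solution_on c e u ->
  exists b d, d <= e /\ solution_coefs c d b /\
    d <= / (20 * (Rabs c + 1)) /\
    (forall t, Rabs t < d -> u t = t * PSeries b t).
Proof.
  intros He [Han [Hu0 [Hu1 Hode]]].
  assert (H0e : Rabs 0 < e) by (rewrite Rabs_R0; exact He).
  destruct (analytic_at_PS u 0 (Han 0 H0e)) as [a [d0 [Hd0 [HCV Ha]]]].
  pose proof (admissible_radius c) as Had. set (rho := / (20 * (Rabs c + 1))) in *.
  assert (Hc : Rabs c < Rabs c + 1) by lra.
  assert (Hrho : 0 < rho) by apply Had.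
  set (d := Rmin d0 (Rmin e rho)).
  assert (Hd : 0 < d) by (repeat apply Rmin_pos; assumption).
  assert (Hdd0 : d <= d0) by apply Rmin_l.
  assert (Hde : d <= e) by (eapply Rle_trans; [apply Rmin_r|apply Rmin_l]).
  assert (Hdr : d <= rho) by (eapply Rle_trans; [apply Rmin_r|apply Rmin_r]).
  assert (Ha0 : a 0%nat = 0).
  { rewrite <- PSeries_0, <- Ha, Rplus_0_r by (rewrite Rabs_R0; exact Hd0). exact Hu0. }
  set (b := PS_decr_1 a).
  assert (HCVb : forall t, Rabs t < d -> Rbar_lt (Rabs t) (CV_radius b)).
  { intros t Ht. unfold b. rewrite CV_radius_decr_1. apply HCV. lra. }
  assert (Hub : forall t, Rabs t < d -> u t = t * PSeries b t).
  { intros t Ht. rewrite <- (Rplus_0_l t) at 1. rewrite Ha by lra.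
    apply PSeries_decr_1_aux, Ha0. }
  pose proof (derive_radial d u (PSeries b) (PSeries (euler b)) (PSeries (PS_derive b))
    (PSeries (PS_derive (euler b))) Hub (fun t _ => PSeries_euler b t)
    (fun t Ht => is_derive_PSeries b t (HCVb t Ht))
    (fun t Ht => is_derive_PSeries (euler b) t
       (eq_ind_r (fun R_ => Rbar_lt (Rabs t) R_) (HCVb t Ht) (CV_radius_euler b)))) as Hder.
  exists b, d. split; [exact Hde|]. split; [|split; [exact Hdr|exact Hub]].
  split; [exact Hd|split; [|split; [exact HCVb|]]].
  - assert (Hd00 : Rabs 0 < d) by (rewrite Rabs_R0; exact Hd).
    rewrite (proj1 (Hder 0 Hd00)), !PSeries_0 in Hu1. unfold euler in Hu1. simpl in Hu1. lra.
  - intros t Ht Ht0. rewrite (PSeries_euler (euler b)).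
    apply (ode_iff_reduced rho (Rabs c + 1) c t u (PSeries b t) (PSeries (euler b) t)
      (PSeries (PS_derive b) t) (PSeries (PS_derive (euler b)) t) Had Hc); try assumption.
    + lra.
    + apply Hub, Ht.
    + apply PSeries_euler.
    + apply Hder, Ht.
    + apply Hder, Ht.
    + apply Hode; [lra|exact Ht0].
Qed.

Lemma q_0 c : ev q_series c 0 = 0.
Proof.
  unfold ev. rewrite PSeries_0. unfold rowsum.
  rewrite (PSeries_ext _ null_row); [apply PSeries_const_0|].
  intros n. rewrite q_row_0. reflexivity.
Qed.

Lemma euler_minus b1 b2 n : euler (PS_minus b1 b2) n = PS_minus (euler b1) (euler b2) n.
Proof.
  unfold euler, PS_minus, PS_plus, PS_opp, plus, opp; simpl. ring.
Qed.

(** Where the coefficients of two solutions first differ, at order [n] and by [x],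
    the lowest order of the difference of the equations is [n * (n + 3) * x]. *)
Lemma solution_coefs_unique c d1 d2 b1 b2 :
  solution_coefs c d1 b1 -> solution_coefs c d2 b2 -> forall n, b1 n = b2 n.
Proof.
  intros [Hd1 [Hb1 [HCV1 Heq1]]] [Hd2 [Hb2 [HCV2 Heq2]]].
  intros n. induction n as [n IH] using lt_wf_ind.
  destruct (Nat.eq_dec n 0) as [->|Hn]; [rewrite Hb1, Hb2; reflexivity|].
  set (d := Rmin d1 d2).
  assert (Hd : 0 < d) by (apply Rmin_pos; assumption).
  assert (Hdd1 : d <= d1) by apply Rmin_l. assert (Hdd2 : d <= d2) by apply Rmin_r.
  set (b := PS_minus b1 b2).
  assert (Hb : forall k, (k < n)%nat -> b k = 0).
  { intros k Hk. unfold b, PS_minus, PS_plus, PS_opp, plus, opp; simpl.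
    rewrite (IH k Hk). ring. }
  assert (Heb : forall k, (k < n)%nat -> euler b k = 0).
  { intros k Hk. unfold euler. rewrite (Hb k Hk). ring. }
  assert (Heeb : forall k, (k < n)%nat -> euler (euler b) k = 0).
  { intros k Hk. unfold euler at 1. rewrite (Heb k Hk). ring. }
  assert (HCV : Rbar_lt 0 (CV_radius b)).
  { rewrite <- Rabs_R0. apply (ex_pseries_CV_radius b (d / 2)).
    - apply ex_pseries_minus; apply CV_radius_inside;
        [apply HCV1|apply HCV2]; rewrite Rabs_pos_eq; lra.
    - rewrite Rabs_R0, Rabs_pos_eq; lra. }
  assert (Hin : forall t, Rabs t < d ->
     ex_pseries b1 t /\ ex_pseries b2 t /\
     ex_pseries (euler b1) t /\ ex_pseries (euler b2) t /\
     ex_pseries (euler (euler b1)) t /\ ex_pseries (euler (euler b2)) t).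
  { intros t Ht. repeat split; apply CV_radius_inside; rewrite ?CV_radius_euler;
      first [apply HCV1; lra | apply HCV2; lra]. }
  set (g := PSeries (PS_decr_n b n)).
  set (ge := PSeries (PS_decr_n (euler b) n)).
  set (gee := PSeries (PS_decr_n (euler (euler b)) n)).
  assert (Hg : forall t, Rabs t < d -> PSeries b1 t = PSeries b2 t + t ^ n * g t).
  { intros t Ht. unfold g. rewrite <- (PSeries_decr_n_aux b n t Hb).
    unfold b. rewrite PSeries_minus by apply (Hin t Ht). ring. }
  assert (Hge : forall t, Rabs t < d ->
    PSeries (euler b1) t = PSeries (euler b2) t + t ^ n * ge t).
  { intros t Ht. unfold ge. rewrite <- (PSeries_decr_n_aux _ n t Heb).
    unfold b. rewrite (PSeries_ext _ _ t (euler_minus b1 b2)),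
      PSeries_minus by apply (Hin t Ht). ring. }
  assert (Hgee : forall t, Rabs t < d ->
    PSeries (euler (euler b1)) t = PSeries (euler (euler b2)) t + t ^ n * gee t).
  { intros t Ht. unfold gee. rewrite <- (PSeries_decr_n_aux _ n t Heeb).
    assert (He2 : forall k, euler (euler b) k = PS_minus (euler (euler b1)) (euler (euler b2)) k).
    { intros k. unfold euler at 1. unfold b. rewrite euler_minus.
      unfold euler, PS_minus, PS_plus, PS_opp, plus, opp; simpl. ring. }
    rewrite (PSeries_ext _ _ t He2), PSeries_minus by apply (Hin t Ht). ring. }
  set (q := ev q_series c).
  set (y1 := PSeries b1). set (y2 := PSeries b2).
  set (p1 := PSeries (euler b1)). set (p2 := PSeries (euler b2)).
  set (s2 := PSeries (euler (euler b2))).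
  (* the difference of the two reduced equations, divided by [t ^ n] *)
  set (h := fun t =>
    (gee t + ge t) * (y1 t ^ 2 - c ^ 2 * q t ^ 2)
    + (s2 t + p2 t) * (g t * (y1 t + y2 t))
    + 2 * ((g t + ge t) * (y1 t * p1 t + 2 * c ^ 2 * t * q t * (1 - q t ^ 2))
           + (y2 t + p2 t) * (g t * p1 t + y2 t * ge t))
    - 4 * (t * q t) * ((g t + ge t) * (y1 t ^ 2 - c ^ 2 * q t ^ 2)
           + (y2 t + p2 t) * (g t * (y1 t + y2 t)))).
  assert (Hh : h 0 = 0).
  { apply accumulating_zeros.
    - assert (H0d : Rabs 0 < d) by (rewrite Rabs_R0; exact Hd).
      pose proof (admissible_radius c) as Had. pose proof Had as [[Hr0 Hr1] [Ht _]].
      assert (Eg : ex_derive g 0).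
      { apply ex_derive_PSeries_0. rewrite CV_radius_decr_n. exact HCV. }
      assert (Ege : ex_derive ge 0).
      { apply ex_derive_PSeries_0. rewrite CV_radius_decr_n, CV_radius_euler. exact HCV. }
      assert (Egee : ex_derive gee 0).
      { apply ex_derive_PSeries_0. rewrite CV_radius_decr_n, !CV_radius_euler. exact HCV. }
      assert (Ey1 : ex_derive y1 0) by (apply ex_derive_PSeries, HCV1; lra).
      assert (Ey2 : ex_derive y2 0) by (apply ex_derive_PSeries, HCV2; lra).
      assert (Ep1 : ex_derive p1 0).
      { apply ex_derive_PSeries. rewrite CV_radius_euler. apply HCV1; lra. }
      assert (Ep2 : ex_derive p2 0).
      { apply ex_derive_PSeries. rewrite CV_radius_euler. apply HCV2; lra. }
      assert (Es2 : ex_derive s2 0).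
      { apply ex_derive_PSeries. rewrite !CV_radius_euler. apply HCV2; lra. }
      assert (Eq : ex_derive q 0).
      { eexists. eapply (is_derive_ev _ (Rabs c + 1)); [apply q_series_bounded|lra|].
        - split; [apply Rlt_le, Hr0|lra].
        - lra.
        - rewrite Rabs_R0. exact Hr0. }
      unfold h. auto_derive. repeat split; assumption.
    - intros d' Hd'. exists (Rmin d d' / 2).
      pose proof (Rmin_l d d'). pose proof (Rmin_r d d').
      assert (Hm : 0 < Rmin d d') by (apply Rmin_pos; assumption).
      set (t := Rmin d d' / 2) in *. assert (Ht : 0 < t < d) by (unfold t; lra).
      assert (Hta : Rabs t = t) by (apply Rabs_pos_eq; lra).
      split; [rewrite Hta; unfold t; lra|].
      assert (Htd : Rabs t < d) by lra.
      pose proof (Heq1 t) as E1. pose proof (Heq2 t) as E2.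
      specialize (E1 ltac:(lra) ltac:(lra)). specialize (E2 ltac:(lra) ltac:(lra)).
      unfold reduced in E1, E2.
      apply (Rmult_eq_reg_l (t ^ n)); [|apply pow_nonzero; lra].
      rewrite Rmult_0_r. unfold h, y1, y2, p1, p2, s2, q.
      rewrite (Hg t Htd), (Hge t Htd), (Hgee t Htd) in E1.
      rewrite (Hg t Htd), (Hge t Htd).
      transitivity (0 - 0); [|ring]. rewrite <- E1 at 1. rewrite <- E2. ring. }
  unfold h in Hh.
  assert (Hq0 : q 0 = 0) by apply q_0.
  assert (Hy10 : y1 0 = 1) by (unfold y1; rewrite PSeries_0; exact Hb1).
  assert (Hy20 : y2 0 = 1) by (unfold y2; rewrite PSeries_0; exact Hb2).
  assert (Hp10 : p1 0 = 0) by (unfold p1; rewrite PSeries_0; apply Rmult_0_l).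
  assert (Hp20 : p2 0 = 0) by (unfold p2; rewrite PSeries_0; apply Rmult_0_l).
  assert (Hs20 : s2 0 = 0) by (unfold s2; rewrite PSeries_0; apply Rmult_0_l).
  assert (Hg0 : g 0 = b n).
  { unfold g. rewrite PSeries_0. unfold PS_decr_n. f_equal; lia. }
  assert (Hge0 : ge 0 = INR n * b n).
  { unfold ge. rewrite PSeries_0. unfold PS_decr_n. rewrite Nat.add_0_r. reflexivity. }
  assert (Hgee0 : gee 0 = INR n * (INR n * b n)).
  { unfold gee. rewrite PSeries_0. unfold PS_decr_n. rewrite Nat.add_0_r. reflexivity. }
  rewrite Hq0, Hy10, Hy20, Hp10, Hp20, Hs20, Hg0, Hge0, Hgee0 in Hh.
  assert (Hbn : INR n * (INR n + 3) * b n = 0) by (rewrite <- Hh; ring).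
  assert (Hn0 : 0 < INR n) by (apply lt_0_INR; lia).
  assert (Hbn0 : b n = 0).
  { apply Rmult_integral in Hbn. destruct Hbn as [Hbn|Hbn]; [nra|exact Hbn]. }
  unfold b, PS_minus, PS_plus, PS_opp, plus, opp in Hbn0; simpl in Hbn0. lra.
Qed.

(** * Oddness *)

Lemma q_odd rho tau c r : admissible rho tau -> Rabs c < tau -> Rabs r < rho -> r <> 0 ->
  ev q_series c (- r) = - ev q_series c r.
Proof.
  intros Had Hc Hr Hr0.
  assert (Hrn : Rabs (- r) < rho) by (rewrite Rabs_Ropp; exact Hr).
  pose proof (cosh_sinh_q rho tau c r Had Hc Hr) as H1.
  pose proof (cosh_sinh_q rho tau c (- r) Had Hc Hrn) as H2.
  assert (Hs : sinh (2 * r) <> 0) by (apply sinh_neq0; lra).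
  assert (Hch : cosh (2 * - r) = cosh (2 * r)).
  { unfold cosh. replace (- (2 * - r)) with (2 * r) by ring.
    replace (2 * - r) with (- (2 * r)) by ring. field. }
  assert (Hsh : sinh (2 * - r) = - sinh (2 * r)).
  { unfold sinh. replace (- (2 * - r)) with (2 * r) by ring.
    replace (2 * - r) with (- (2 * r)) by ring. field. }
  rewrite Hch, Hsh in H2.
  apply (Rmult_eq_reg_l (sinh (2 * r) * r)).
  - lra.
  - apply Rmult_integral_contrapositive_currified; assumption.
Qed.

Lemma PSeries_alternate b t : PSeries (fun n => (-1) ^ n * b n) t = PSeries b (- t).
Proof.
  rewrite !PSeries_Series. apply Series_ext. intros n.
  replace (- t) with (-1 * t) by ring. rewrite Rpow_mult_distr. ring.
Qed.

(** [v / r] may be replaced by its reflection, since [q] is odd and the reduced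
    equation is invariant under the change of sign of both [r] and [q]. *)
Lemma solution_coefs_alternate c d b : d <= / (20 * (Rabs c + 1)) ->
  solution_coefs c d b -> solution_coefs c d (fun n => (-1) ^ n * b n).
Proof.
  intros Hdr [Hd [Hb [HCV Heq]]].
  split; [exact Hd|split; [|split]].
  - simpl. rewrite Hb. ring.
  - intros t Ht. destruct (between_radii t d Ht) as [s [Hts Hs]].
    apply (ex_pseries_CV_radius _ s).
    + apply ex_pseries_R. apply (ex_series_ext (fun n => b n * (- s) ^ n)).
      * intros n. replace (- s) with (-1 * s) by ring. rewrite Rpow_mult_distr.
        match goal with |- @eq _ ?x ?y => change (@eq R x y) end. ring.
      * apply ex_pseries_R, CV_radius_inside, HCV. rewrite Rabs_Ropp, Rabs_pos_eq; lra.
    + rewrite (Rabs_pos_eq s); lra.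
  - intros t Ht Ht0.
    assert (He : forall b n, euler (fun n => (-1) ^ n * b n) n = (-1) ^ n * euler b n).
    { intros b' n. unfold euler. ring. }
    assert (Hee : forall n, euler (euler (fun n => (-1) ^ n * b n)) n =
                            (-1) ^ n * euler (euler b) n).
    { intros n. unfold euler. ring. }
    rewrite (PSeries_ext _ _ t (He b)), (PSeries_ext _ _ t Hee), !PSeries_alternate.
    assert (Htn : Rabs (- t) < d) by (rewrite Rabs_Ropp; exact Ht).
    assert (Htn0 : - t <> 0) by lra.
    rewrite <- (Heq (- t) Htn Htn0).
    rewrite (q_odd _ (Rabs c + 1) c t (admissible_radius c)); try assumption; try lra.
    unfold reduced. ring.
Qed.

Lemma solution_on_shrink c d d' v : d' <= d -> solution_on c d v -> solution_on c d' v.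
Proof.
  intros Hd [H1 [H2 [H3 H4]]]. split; [|split; [exact H2|split; [exact H3|]]].
  - intros r Hr. apply H1. lra.
  - intros r Hr. apply H4. lra.
Qed.

Theorem proposition4p2 :
  exists v : R -> R -> R,
    (forall c : R, exists d : R,
       0 < d /\
       solution_on c d (v c) /\
       (forall (e : R) (u : R -> R), 0 < e -> solution_on c e u ->
          forall r : R, Rabs r < d -> Rabs r < e -> u r = v c r) /\
       (forall r : R, Rabs r < d -> v c (- r) = - v c r)) /\
    (forall c0 : R,
       analytic2_at v c0 0 /\
       exists rho : R,
         0 < rho /\
         forall c : R, Rabs (c - c0) < rho -> solution_on c rho (v c)).
Proof.
  exists (ev v_series). split.
  - intros c. pose proof (admissible_radius c) as Had.
    set (rho := / (20 * (Rabs c + 1))) in *.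
    assert (Hrho : 0 < rho) by apply Had.
    assert (Hsol : solution_on c rho (ev v_series c)).
    { apply (v_solution rho (Rabs c + 1)); [exact Had|lra]. }
    destruct (solution_coefs_of_solution c rho _ Hrho Hsol) as [b [d [Hdr [Hb [_ Hvb]]]]].
    pose proof (solution_on_shrink c rho d _ Hdr Hsol) as Hsold.
    assert (Hd : 0 < d) by apply Hb.
    exists d. split; [exact Hd|split; [exact Hsold|split]].
    + intros e u He Hu r Hrd Hre.
      destruct (solution_coefs_of_solution c e u He Hu) as [b' [d' [_ [Hb' [_ Hub']]]]].
      assert (Hd' : 0 < d') by apply Hb'.
      apply Rminus_diag_uniq.
      apply (identity_theorem (fun r => u r - ev v_series c r) (Rmin d e)).
      * intros t Ht. pose proof (Rmin_l d e). pose proof (Rmin_r d e).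
        apply analytic_at_minus; [apply Hu; lra|apply Hsold; lra].
      * exists (Rmin d d'). split; [apply Rmin_pos; assumption|].
        intros t Ht. pose proof (Rmin_l d d'). pose proof (Rmin_r d d').
        rewrite Hub', Hvb by lra.
        rewrite (PSeries_ext b' b t (solution_coefs_unique c d' d b' b Hb' Hb)). ring.
      * apply Rmin_glb_lt; assumption.
    + intros r Hr. rewrite !Hvb by (rewrite ?Rabs_Ropp; exact Hr).
      rewrite <- PSeries_alternate.
      rewrite (PSeries_ext _ b r (solution_coefs_unique c d d _ b
        (solution_coefs_alternate c d b Hdr Hb) Hb)). ring.
  - intros c0. pose proof (admissible_radius c0) as Had.
    set (rho := / (20 * (Rabs c0 + 1))) in *.
    destruct (v_series_bounded _ _ Had) as [A HA].
    pose proof Had as [[Hrho Hrho1] _].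
    split; [apply (analytic2_ev rho A); assumption|].
    exists rho. split; [exact Hrho|]. intros c Hc.
    apply (v_solution rho (Rabs c0 + 1)); [exact Had|].
    pose proof (Rabs_triang_inv c c0). lra.
Qed.
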